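(* Let $g\in\mathcal{L}$, let $n\ge1$, $\mathbb{A}=(A_1,\dots,A_n)\in\mathcal{P}^n$ and $\omega\in\Delta_n$. If $\sigma_g(\omega;\mathbb{A})\le I$, then $$\sigma_{g_p}(\omega;\mathbb{A}^p)\le I\qquad\text{for all } p\ge1,$$ where $g_p(x):=p\,g(x^{1/p})$ and $\mathbb{A}^p=(A_1^p,\dots,A_n^p)$. Moreover, for all $p\ge 1$ and $\lambda\in[0,1]$, the representing function of the $\lambda$-weighted operator mean $\sigma_{g_p}$ is $$f_{p,\lambda}(x):=f_\lambda(x^{1/p})^p\qquad (x>0),$$ where $f_\lambda$ is the representing function of the $\lambda$-weighted operator mean $\sigma_g$.
   Context: $\mathcal{H}$ is a Hilbert space, $I$ is the identity operator, $\mathcal{P}$ is the set of invertible positive semi-definite bounded operators on $\mathcal{H}$, and $A\ge B$ for self-adjoint $A,B$ means $A-B$ is positive semi-definite. $\Delta_n=\{(w_1,\dots,w_n)\in(0,1)^n:\sum_i w_i=1\}$ (for $n=1$ the weight is $1$). A real-valued function $g$ on $(0,\infty)$ is operator monotone if $B\le A$ implies $g(B)\le g(A)$ for all self-adjoint bounded operators $A,B$ on a Hilbert space with spectra in $(0,\infty)$ (for every Hilbert space). $\mathcal{L}$ denotes the set of all operator monotone functions $g$ on $(0,\infty)$ with $g(1)=0$, $g'(1)=1$; one has $g_p\in\mathcal{L}$ for $g\in\mathcal{L}$ and $p\ge1$. For $g\in\mathcal{L}$, $\omega=(w_1,\dots,w_n)\in\Delta_n$ and $\mathbb{A}\in\mathcal{P}^n$,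 $\sigma_g(\omega;\mathbb{A})$ denotes the solution $X\in\mathcal{P}$, which exists and is unique (a known theorem of Pálfia), of the generalized Karcher equation $$\sum_{i=1}^n w_i\,g(X^{-1/2}A_iX^{-1/2})=0 .$$ For $h\in\mathcal{L}$ and $\lambda\in[0,1]$, the representing function of the $\lambda$-weighted operator mean $\sigma_h$ is the function on $(0,\infty)$ whose value at $x$ is $\sigma_h((1-\lambda,\lambda);1,x)$, i.e. the unique $y>0$ with $(1-\lambda)h(1/y)+\lambda h(x/y)=0$ (this equation also defines it for $\lambda=0,1$). *)

(* Defs.v *)
From mathcomp Require Import all_boot all_order all_algebra sesquilinear.
From mathcomp Require Import complex.
From mathcomp Require Import boolp classical_sets reals topology normedtype.
From mathcomp Require Import derive exp.

Set Implicit Arguments.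
Unset Strict Implicit.
Unset Printing Implicit Defensive.

Import Order.TTheory GRing.Theory Num.Theory.
Import numFieldNormedType.Exports.

Local Open Scope classical_set_scope.
Local Open Scope ring_scope.
Local Open Scope complex_scope.

(** Complex Hilbert spaces; the inner product is linear in its first argument
    and conjugate-linear in its second one. *)
Record hilbertType (R : realType) := Hilbert {
  hilbert_sort :> completeNormedModType R[i];
  hdot : {dot hilbert_sort for (Num.conj : R[i] -> R[i])};
  hdot_norm : forall v : hilbert_sort, `|v| ^+ 2 = hdot v v }.

(** Operators are plain functions [H -> H]; boundedness is stated as continuity
    (see [linear_bounded_continuous]). *)
Section Operators.
Variables (R : realType) (H : hilbertType R).
Implicit Types (A B X : H -> H) (f : R -> R).

Definition bounded_op A := linear A /\ continuous A.

Definition selfadjoint A := forall u v : H, hdot H (A u) v = hdot H u (A v).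

Definition psd A := selfadjoint A /\ forall v : H, 0 <= hdot H (A v) v.

Definition op_le B A := psd (fun v => A v - B v).

Definition invertible_op A :=
  exists B, [/\ bounded_op B, cancel A B & cancel B A].

Definition spectrum A : set R[i] :=
  [set z | ~ invertible_op (fun v => A v - z *: v)].

Definition posdef A := [/\ bounded_op A, psd A & invertible_op A].

Definition poly_op (p : {poly R}) A : H -> H :=
  fun v => \sum_(i < size p) (p`_i)%:C *: iter i A v.

(** Continuous functional calculus of a bounded self-adjoint [A] (whose spectrum
    is real): [B] is [f(A)] when real polynomials [p] arbitrarily close to [f]
    uniformly on the spectrum of [A] have [p(A)] arbitrarily close to [B] in
    operator norm. *)
Definition is_fcalc f A B :=
  bounded_op B /\
  forall e : R, 0 < e -> exists p : {poly R},
    (forall t : R, spectrum A t%:C -> `|p.[t] - f t| <= e) /\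
    (forall v : H, `|poly_op p A v - B v| <= e%:C * `|v|).

(** The default value [0] is only reached when [f] is not continuous on the
    spectrum of [A]. *)
Definition fcalc f A : H -> H := xget (fun=> 0) [set B | is_fcalc f A B].

Definition op_powR A (a : R) : H -> H := fcalc (fun t => t `^ a) A.

End Operators.

(** Continuity of [g] is not required: the finite-dimensional instances, where
    every function is continuous on the spectrum, already force it. In [R[i]],
    [0 < z] says that [z] is real and positive. *)
Definition operator_monotone (R : realType) (g : R -> R) :=
  forall (H : hilbertType R) (A B : H -> H),
    bounded_op A -> selfadjoint A -> spectrum A `<=` [set z | 0 < z] ->
    bounded_op B -> selfadjoint B -> spectrum B `<=` [set z | 0 < z] ->
    op_le B A -> op_le (fcalc g B) (fcalc g A).

(** The class $\mathcal{L}$; only the values of [g] on positive reals matter. *)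
Definition normalized_monotone (R : realType) (g : R -> R) :=
  [/\ operator_monotone g, g 1 = 0 & is_derive (1 : R) 1 g 1].

(** For [n >= 2] the bounds [w i < 1] follow; for [n = 1] the weight is [1]. *)
Definition weight (R : realType) n (w : 'I_n -> R) :=
  (forall i, 0 < w i) /\ \sum_i w i = 1.

Definition is_karcher_mean (R : realType) (H : hilbertType R) (g : R -> R) n
    (w : 'I_n -> R) (A : 'I_n -> H -> H) (X : H -> H) :=
  posdef X /\
  let S := op_powR X (- 2^-1) in
  forall v : H, \sum_i (w i)%:C *: fcalc g (S \o A i \o S) v = 0.

Definition power_transform (R : realType) (p : R) (g : R -> R) : R -> R :=
  fun x => p * g (x `^ p^-1).

Definition scalar_mean_eq (R : realType) (h : R -> R) (lambda x y : R) :=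
  0 < y /\ (1 - lambda) * h (1 / y) + lambda * h (x / y) = 0.

Definition is_representing_function (R : realType) (h : R -> R) (lambda : R)
    (f : R -> R) :=
  forall x : R, 0 < x ->
    scalar_mean_eq h lambda x (f x) /\
    forall y : R, scalar_mean_eq h lambda x y -> y = f x.

(* Main.v *)
Require Import Defs.
From HB Require Import structures.
From mathcomp Require Import all_boot all_order all_algebra sesquilinear.
From mathcomp Require Import complex ring lra.
From mathcomp Require Import boolp classical_sets reals topology normedtype.
From mathcomp Require Import sequences derive exp.

(** Write [A <= B] for the order of quadratic forms and [g_p] for
    [power_transform p g].

    Let [X <= 1] solve the Karcher equation of [g] for the [A_i]. The same [X] is
    a supersolution for every power: Hansen's inequality for the contraction
    [X^(1/2)] and the operator monotone function [t `^ (1/p)] gives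
    [(X^(-1/2) A_i^p X^(-1/2))^(1/p) <= X^(-1/2) A_i X^(-1/2)], and applying [g]
    shows that the Karcher sum of [g_p] at [X] for the [A_i^p] is at most [p] times
    that of [g] at [X] for the [A_i], which is zero ([power_karcher_sum_le0]). A
    comparison principle ([karcher_comparison]) then bounds the solution [Y] of the
    equation of [g_p] by [X], hence by the identity.

    The comparison principle rests on the operator Jensen inequality
    ([omono_jensen]): for an operator monotone [h] and a contraction [K],
    [K h(B) K* + h(d) (1 - K K* ) <= h(K B K* + d (1 - K K* ))], up to a factor
    arbitrarily close to [1] inside [h]. Following Hansen and Pedersen, dilate [K]
    to an isometry [V] from [H] to [H + H] and apply the monotonicity of [h] on
    [H + H], which is why monotonicity is assumed on every Hilbert space. Let [t]
    be the least number with [Y <= t X], and suppose [t > 1]. Then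
    [K = (t X)^(-1/2) Y^(1/2)] is a contraction that carries the equation of [Y] to
    that of [t X]. The Karcher sum at [t X] is strictly negative, so the Jensen
    inequality bounds [1 - K K*] below by a positive constant; this contradicts the
    choice of [t] ([improve_bound]).

    The strict negativity comes from scalar analysis. The Jensen inequality for
    scalar operators says that [h] is concave; so [h] is locally Lipschitz, which
    makes its functional calculus available, and it increases at a definite rate
    as long as it stays below its value at [2] ([omono_div_le]). This value is
    positive because [g] has derivative [1] at [1] ([omono_gt0]).

    That powers [t `^ r] with [0 <= r <= 1] are operator monotone ([loewner_heinz])
    is proved by bisection on [r], the midpoint step comparing the spectra of two
    similar operators.

    All of this needs the continuous functional calculus of a bounded symmetric
    operator. Positivity of [p(A)] for [p] nonnegative on the spectrum
    ([poly_op_ge0]) gives the norm estimate for polynomials; completeness and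
    Bernstein polynomials give existence; and the fact that the calculus commutes
    with intertwining operators ([is_fcalc_intertwine]) gives uniqueness and the
    calculus of block operators.

    The statement on representing functions is the substitution
    [y = z `^ p] in the scalar equation ([representing_function_power]). *)

Set Implicit Arguments.
Unset Strict Implicit.
Unset Printing Implicit Defensive.

Import Order.TTheory GRing.Theory Num.Theory.
Import numFieldNormedType.Exports.
Local Open Scope classical_set_scope.
Local Open Scope ring_scope.
Local Open Scope complex_scope.

(** * The real inner product of a complex Hilbert space *)

Section RealComplex.
Variable R : realType.
Implicit Types a b : R.

Lemma rcD a b : (a + b : R)%:C = a%:C + b%:C :> R[i].
Proof. exact: rmorphD. Qed.

Lemma rcN a : (- a : R)%:C = - a%:C :> R[i].
Proof. exact: rmorphN. Qed.

Lemma rcB a b : (a - b : R)%:C = a%:C - b%:C :> R[i].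
Proof. exact: rmorphB. Qed.

Lemma rcM a b : (a * b : R)%:C = a%:C * b%:C :> R[i].
Proof. exact: rmorphM. Qed.

Lemma rcX a n : (a ^+ n : R)%:C = a%:C ^+ n :> R[i].
Proof. exact: rmorphXn. Qed.

Lemma rc_norm a : `|a%:C| = (`|a| : R)%:C :> R[i].
Proof. by rewrite normc_def /= expr0n addr0 sqrtr_sqr. Qed.

Lemma sqr_sqrt a : 0 <= a -> Num.sqrt a ^+ 2 = a.
Proof. exact: sqr_sqrtr. Qed.

End RealComplex.

Section RealForm.
Variables (R : realType) (H : hilbertType R).
Implicit Types (u v : H) (a : R).

(** Symmetry and positivity of a complex-linear operator can be read off the
    real part of the inner product, so estimates take place in [R]: multiplying
    a vector by ['i] recovers the imaginary part ([hdot_rdot]). *)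
Definition rdot u v : R := complex.Re (hdot H u v).
Definition rnorm v : R := complex.Re `|v|.

Lemma normE v : `|v| = (rnorm v)%:C.
Proof. by rewrite /rnorm RRe_real// normr_real. Qed.

Lemma rnorm_ge0 v : 0 <= rnorm v.
Proof. by rewrite -ler0c -normE normr_ge0. Qed.

Lemma rdotDl u v x : rdot (u + v) x = rdot u x + rdot v x.
Proof. by rewrite /rdot linearDl raddfD. Qed.

Lemma rdotBl u v x : rdot (u - v) x = rdot u x - rdot v x.
Proof. by rewrite /rdot linearBl raddfB. Qed.

Lemma rdotC u v : rdot u v = rdot v u.
Proof. by rewrite /rdot hermC mul1r /=; case: (hdot H v u). Qed.

Lemma rdotDr u v x : rdot x (u + v) = rdot x u + rdot x v.
Proof. by rewrite !(rdotC x) rdotDl. Qed.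

Lemma rdotBr u v x : rdot x (u - v) = rdot x u - rdot x v.
Proof. by rewrite !(rdotC x) rdotBl. Qed.

Lemma rdotZl a u v : rdot (a%:C *: u) v = a * rdot u v.
Proof. by rewrite /rdot linearZl_LR /=; case: (hdot H u v) => x y /=; ring. Qed.

Lemma rdotZr a u v : rdot u (a%:C *: v) = a * rdot u v.
Proof. by rewrite !(rdotC u) rdotZl. Qed.

Lemma rdotii u v : rdot ('i *: u) ('i *: v) = rdot u v.
Proof.
rewrite /rdot linearZl_LR linearZr_LR /=; case: (hdot H u v) => x y.
by rewrite /=; ring.
Qed.

Lemma rdot0l u : rdot 0 u = 0.
Proof. by rewrite /rdot linear0l. Qed.

Lemma rdot0r u : rdot u 0 = 0.
Proof. by rewrite rdotC rdot0l. Qed.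

Lemma rdotNl u v : rdot (- u) v = - rdot u v.
Proof. by rewrite -[- u]sub0r rdotBl rdot0l sub0r. Qed.

Lemma rdotNr u v : rdot u (- v) = - rdot u v.
Proof. by rewrite rdotC rdotNl rdotC. Qed.

Lemma hdot_rdot u v : hdot H u v = rdot u v +i* rdot u ('i *: v).
Proof.
rewrite /rdot linearZr_LR /=; case: (hdot H u v) => x y /=.
by congr (_ +i* _); ring.
Qed.

Lemma rdotvv v : rdot v v = rnorm v ^+ 2.
Proof. by rewrite /rdot -hdot_norm normE -rcX. Qed.

Lemma rdot_ge0 v : 0 <= rdot v v.
Proof. by rewrite rdotvv exprn_ge0// rnorm_ge0. Qed.

Lemma rnorm_eq0 v : (rnorm v == 0) = (v == 0).
Proof. by rewrite -(inj_eq (@complexI R)) -normE normr_eq0. Qed.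

Lemma rdot_eq0 v : (rdot v v == 0) = (v == 0).
Proof. by rewrite rdotvv sqrf_eq0 rnorm_eq0. Qed.

Lemma rnorm0 : rnorm (0 : H) = 0.
Proof. by rewrite /rnorm normr0. Qed.

Lemma rnormD u v : rnorm (u + v) <= rnorm u + rnorm v.
Proof. by rewrite -lecR rcD -!normE ler_normD. Qed.

Lemma rnormB u v : rnorm (u - v) = rnorm (v - u).
Proof. by rewrite /rnorm distrC. Qed.

Lemma rnormN v : rnorm (- v) = rnorm v.
Proof. by rewrite /rnorm normrN. Qed.

Lemma rnormZ a v : rnorm (a%:C *: v) = `|a| * rnorm v.
Proof.
by apply: complexI; rewrite -normE normrZ rcM rc_norm -normE.
Qed.

Lemma rdot_norm u v : rdot u v <= rnorm u * rnorm v.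
Proof.
have [->|u0] := eqVneq u 0; first by rewrite rdot0l mulr_ge0 ?rnorm_ge0.
have [->|v0] := eqVneq v 0; first by rewrite rdot0r mulr_ge0 ?rnorm_ge0.
have un : 0 < rnorm u by rewrite lt_neqAle eq_sym rnorm_eq0 u0 rnorm_ge0.
have vn : 0 < rnorm v by rewrite lt_neqAle eq_sym rnorm_eq0 v0 rnorm_ge0.
have := rdot_ge0 ((rnorm v)%:C *: u - (rnorm u)%:C *: v).
set w := (X in rdot X X).
have -> : rdot w w =
    2 * (rnorm u * rnorm v) * (rnorm u * rnorm v - rdot u v).
  by rewrite /w !(rdotBl, rdotBr, rdotZl, rdotZr) !rdotvv (rdotC v u); ring.
by rewrite pmulr_rge0 ?subr_ge0// ?mulr_gt0// mulr_gt0.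
Qed.

End RealForm.

(** * The Hilbert sum of two copies of a Hilbert space *)

(** A copy of [H * H] on which to put the Euclidean norm; the product itself
    carries the max norm, which in general no inner product induces. *)
Definition hsum (R : realType) (H : hilbertType R) : Type := (H * H)%type.

Section HilbertSum.
Variables (R : realType) (H : hilbertType R).
Notation T := (hsum H).

HB.instance Definition _ := GRing.Lmodule.copy T (H * H)%type.

Definition sdot (x y : T) : R[i] := hdot H x.1 y.1 + hdot H x.2 y.2.

Lemma sdot_zmodl y : zmod_morphism (applyr sdot y).
Proof. by move=> a b; rewrite /= /sdot /= !linearBl /= opprD addrACA. Qed.

Lemma sdot_zmodr y : zmod_morphism (sdot y).
Proof. by move=> a b; rewrite /= /sdot /= !linearBr /= opprD addrACA. Qed.

Lemma sdot_linl y : scalable_for *%R (applyr sdot y).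
Proof. by move=> k a; rewrite /= /sdot /= !linearZl_LR /= mulrDr. Qed.

Lemma sdot_linr y : scalable_for (Num.conj \; *%R) (sdot y).
Proof. by move=> k a; rewrite /= /sdot /= !linearZr_LR /= mulrDr. Qed.

HB.instance Definition _ := @isBilinear.Build R[i] T T R[i] _ _ sdot
  sdot_zmodl sdot_zmodr sdot_linl sdot_linr.

Lemma sdot_herm x y : sdot x y = (-1) ^+ false * Num.conj (sdot y x).
Proof.
rewrite /sdot mul1r rmorphD /= [hdot _ x.1 _]hermC [hdot _ x.2 _]hermC.
by rewrite !mul1r.
Qed.

HB.instance Definition _ :=
  @isHermitianSesquilinear.Build R[i] T false Num.conj sdot sdot_herm.

Lemma sdot_pos x : x != 0 -> 0 < sdot x x.
Proof.
rewrite /sdot -!hdot_norm; case: x => x y /= nz.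
rewrite lt_neqAle addr_ge0 ?exprn_ge0// andbT eq_sym paddr_eq0 ?exprn_ge0//.
rewrite !sqrf_eq0 !normr_eq0.
by apply: contra nz => /andP[/eqP-> /eqP->]; exact: eqxx.
Qed.

HB.instance Definition _ := isDotProduct.Build R[i] T sdot sdot_pos.

Definition srnorm (x : T) : R := Num.sqrt (rnorm x.1 ^+ 2 + rnorm x.2 ^+ 2).

Definition snorm (x : T) : R[i] := (srnorm x)%:C.

Lemma srnorm_sqr (x : T) : srnorm x ^+ 2 = rnorm x.1 ^+ 2 + rnorm x.2 ^+ 2.
Proof. by rewrite /srnorm sqr_sqrt// addr_ge0 ?sqr_ge0. Qed.

Lemma snorm_sqr (x : T) : snorm x ^+ 2 = sdot x x.
Proof. by rewrite /snorm -rcX srnorm_sqr rcD !rcX -!normE !hdot_norm. Qed.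

Lemma minkowski2 (a b c d : R) : 0 <= a -> 0 <= b -> 0 <= c -> 0 <= d ->
  Num.sqrt ((a + c) ^+ 2 + (b + d) ^+ 2) <=
  Num.sqrt (a ^+ 2 + b ^+ 2) + Num.sqrt (c ^+ 2 + d ^+ 2).
Proof.
move=> a0 b0 c0 d0.
have s0 x y : 0 <= x ^+ 2 + y ^+ 2 :> R by rewrite addr_ge0 ?sqr_ge0.
rewrite -ler_sqr ?nnegrE ?addr_ge0 ?sqrtr_ge0// sqr_sqrt// [leRHS]sqrrD !sqr_sqrt//.
have -> : (a + c) ^+ 2 + (b + d) ^+ 2 =
  a ^+ 2 + b ^+ 2 + (a * c + b * d) *+ 2 + (c ^+ 2 + d ^+ 2) by ring.
rewrite lerD2r lerD2l lerMn2r /= -sqrtrM//.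
rewrite -ler_sqr ?nnegrE ?addr_ge0 ?mulr_ge0 ?sqrtr_ge0// sqr_sqrt ?mulr_ge0//.
rewrite -subr_ge0.
have -> : (a ^+ 2 + b ^+ 2) * (c ^+ 2 + d ^+ 2) - (a * c + b * d) ^+ 2
  = (a * d - b * c) ^+ 2 by ring.
by rewrite sqr_ge0.
Qed.

Lemma snormD (x y : T) : snorm (x + y) <= snorm x + snorm y.
Proof.
rewrite /snorm -rcD lecR.
apply: le_trans (minkowski2 _ _ _ _) => //; rewrite ?rnorm_ge0//.
rewrite ler_sqrt ?addr_ge0 ?sqr_ge0//.
by rewrite lerD// ler_sqr ?nnegrE ?addr_ge0 ?rnorm_ge0// rnormD.
Qed.

Lemma snormZ (l : R[i]) (x : T) : snorm (l *: x) = `|l| * snorm x.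
Proof.
have [m m0 lE] : exists2 m : R, 0 <= m & `|l| = m%:C.
  by exists (complex.Re `|l|); rewrite ?RRe_real ?normr_real// -ler0c RRe_real ?normr_real.
have nZ (v : H) : rnorm (l *: v) = m * rnorm v.
  by apply: complexI; rewrite rcM -!normE normrZ lE.
rewrite /snorm lE -rcM; congr (_%:C).
rewrite /srnorm !nZ !exprMn -mulrDr sqrtrM ?sqr_ge0//.
by rewrite sqrtr_sqr ger0_norm.
Qed.

Lemma snorm0_eq0 (x : T) : snorm x = 0 -> x = 0.
Proof.
move=> /complexI/eqP; rewrite sqrtr_eq0 => h.
have : rnorm x.1 ^+ 2 + rnorm x.2 ^+ 2 == 0.
  by rewrite eq_le h addr_ge0 ?sqr_ge0.
rewrite paddr_eq0 ?sqr_ge0// !sqrf_eq0 !rnorm_eq0.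
by case: x {h} => a b /= /andP[/eqP-> /eqP->].
Qed.

HB.instance Definition _ :=
  Lmodule_isNormed.Build R[i] T snormD snormZ snorm0_eq0.

Lemma snorm_fst (x : T) : `|x.1| <= `|x|.
Proof.
rewrite [`|x|]/(snorm x) normE lecR -ler_sqr ?nnegrE ?sqrtr_ge0 ?rnorm_ge0//.
by rewrite sqr_sqrt ?lerDl ?addr_ge0 ?sqr_ge0.
Qed.

Lemma snorm_snd (x : T) : `|x.2| <= `|x|.
Proof.
rewrite [`|x|]/(snorm x) normE lecR -ler_sqr ?nnegrE ?sqrtr_ge0 ?rnorm_ge0//.
by rewrite sqr_sqrt ?lerDr ?addr_ge0 ?sqr_ge0.
Qed.

Lemma snorm_le (x : T) : `|x| <= `|x.1| + `|x.2|.
Proof.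
rewrite [`|x|]/(snorm x) !normE -rcD lecR.
rewrite -ler_sqr ?nnegrE ?addr_ge0 ?sqrtr_ge0 ?rnorm_ge0//.
rewrite sqr_sqrt ?addr_ge0 ?sqr_ge0// sqrrD -addrA lerD2l lerDr.
by rewrite mulrn_wge0// mulr_ge0 ?rnorm_ge0.
Qed.

(** Both projections are nonexpansive, so a Cauchy filter converges in each
    component. *)
Lemma hsum_complete (F : set_system T) : ProperFilter F -> cauchy F -> cvg F.
Proof.
move=> FF /cauchyP F_cauchy.
have proj_c (f : T -> H) : (forall x y : T, `|f x - f y| <= `|x - y|) ->
    cauchy (f @ F).
  move=> f1; apply/cauchyP => e e0.
  have [x Fx] := F_cauchy e e0; exists (f x).
  change (F (f @^-1` ball (f x) e)).
  by apply: filterS Fx => y; rewrite -!ball_normE /=; exact: le_lt_trans.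
have /cauchy_cvg/cvg_ex[/= a Fa] : cauchy (fst @ F).
  by apply: proj_c => x y; rewrite (snorm_fst (x - y)).
have /cauchy_cvg/cvg_ex[/= b Fb] : cauchy (snd @ F).
  by apply: proj_c => x y; rewrite (snorm_snd (x - y)).
apply/cvg_ex; exists ((a, b) : T).
apply/cvgrPdist_lt => e e0; near=> x.
apply: le_lt_trans (snorm_le _) _ => /=.
rewrite (splitr e) ltrD//; near: x.
  by move/cvgrPdist_lt: Fa; apply; rewrite divr_gt0.
by move/cvgrPdist_lt: Fb; apply; rewrite divr_gt0.
Unshelve. all: by end_near. Qed.

HB.instance Definition _ := Uniform_isComplete.Build T hsum_complete.

Definition hsumH : hilbertType R :=
  @Hilbert R (hsum H : completeNormedModType R[i]) sdot snorm_sqr.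

End HilbertSum.

(** * Bounded and symmetric operators *)

Section OperatorBasics.
Variables (R : realType) (H H' : hilbertType R).
Implicit Types (A B : H -> H) (T : H -> H').

Lemma linD T u v : linear T -> T (u + v) = T u + T v.
Proof. by move=> lT; have := lT 1 u v; rewrite !scale1r. Qed.

Lemma lin0 T : linear T -> T 0 = 0.
Proof.
move=> lT; have := linD 0 0 lT; rewrite addr0 -[LHS]addr0.
by move=> /addrI.
Qed.

Lemma linZ T a u : linear T -> T (a *: u) = a *: T u.
Proof. by move=> lT; have := lT a u 0; rewrite lin0// !addr0. Qed.

Lemma linN T u : linear T -> T (- u) = - T u.
Proof. by move=> lT; rewrite -scaleN1r linZ// scaleN1r. Qed.

Lemma linB T u v : linear T -> T (u - v) = T u - T v.
Proof. by move=> lT; rewrite linD// linN. Qed.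

Lemma lin_sum T n (F : 'I_n -> H) : linear T ->
  T (\sum_(i < n) F i) = \sum_(i < n) T (F i).
Proof.
move=> lT; elim/big_rec2: _ => [|i y z _ <-]; first exact: lin0.
exact: linD.
Qed.

Definition op_bound (k : R) T := forall v, rnorm (T v) <= k * rnorm v.

Definition bdd T := exists k, op_bound k T.

Lemma bddP T : bdd T -> exists2 k, 0 < k & op_bound k T.
Proof.
move=> [k Tk]; exists (`|k| + 1); first by rewrite ltr_wpDl.
move=> v; apply: le_trans (Tk v) _; rewrite ler_wpM2r ?rnorm_ge0//.
by rewrite (le_trans (ler_norm _))// lerDl.
Qed.

Lemma lin_continuousP T : linear T -> (continuous T <-> bdd T).
Proof.
move=> lT.
pose f : {linear H -> H'} := HB.pack T (GRing.isLinear.Build _ _ _ _ T lT).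
split=> [cT|/bddP[k k0 Tk]].
  have /linear_boundedP[M [Mr bM]] : bounded_near f (nbhs 0).
    exact/linear_bounded_continuous.
  have {}bM := bM (M + 1); rewrite ltrDl ltr01 in bM.
  exists (complex.Re (M + 1)) => v.
  by rewrite -lecR rcM -!normE RRe_real ?(bM isT)// realD ?real1.
apply/(linear_bounded_continuous f)/(linear_boundedP f).
exists k%:C; split; first by apply/complex_realP; exists k.
move=> y ky v; rewrite (le_trans (y := k%:C * `|v|))//.
  by rewrite !normE -rcM lecR.
by rewrite ler_wpM2r// ltW.
Qed.

End OperatorBasics.

Section SymmetricOperators.
Variables (R : realType) (H : hilbertType R).
Implicit Types (A B T : H -> H) (u v : H).

Lemma bounded_opP T : bounded_op T <-> linear T /\ bdd T.
Proof.
by split=> -[lT bT]; split=> //; apply/lin_continuousP.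
Qed.

Definition sym T := forall u v, rdot (T u) v = rdot u (T v).

Lemma selfadjointP T : linear T -> selfadjoint T <-> sym T.
Proof.
move=> lT; split=> [sT u v|sT u v]; first by rewrite /rdot sT.
by rewrite !hdot_rdot sT; congr (_ +i* _); rewrite sT linZ.
Qed.

(** For symmetric [T], [rdot (T v) ('i *: v)] equals its own opposite, so the
    form is real. *)
Lemma psdP T : linear T ->
  psd T <-> sym T /\ forall v, 0 <= rdot (T v) v.
Proof.
move=> lT; split=> -[sT pT].
  split=> [|v]; first exact/selfadjointP.
  by have := pT v; rewrite lecE => /andP[_].
split=> [|v]; first exact/selfadjointP.
rewrite lecE hdot_rdot /= pT andbT.
have : rdot (T v) ('i *: v) = - rdot (T v) ('i *: v).
  rewrite {1}sT linZ// -rdotii scalerA.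
  by rewrite (_ : 'i * 'i = (-1)%:C) ?rdotZr ?mulN1r ?(rdotC ('i *: v))//; simpc.
by move=> /eqP; rewrite -addr_eq0 -mulr2n mulrn_eq0.
Qed.

Lemma op_leP A B : linear A -> linear B -> sym A -> sym B ->
  op_le B A <-> forall v, rdot (B v) v <= rdot (A v) v.
Proof.
move=> lA lB sA sB.
have lD : linear (fun v => A v - B v).
  by move=> a u v; rewrite lA lB scalerBr opprD addrACA.
split=> [/psdP -/(_ lD)[_ p] v|p].
  by have := p v; rewrite rdotBl subr_ge0.
apply/psdP => //; split=> [u v|v]; last by rewrite rdotBl subr_ge0.
by rewrite rdotBl rdotBr sA sB.
Qed.

(** The form at [u + s v] is a nonnegative quadratic polynomial in [s]; evaluate
    it at its minimum. *)
Lemma form_cauchy_schwarz T u v : linear T -> sym T ->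
  (forall x, 0 <= rdot (T x) x) ->
  rdot (T u) v ^+ 2 <= rdot (T u) u * rdot (T v) v.
Proof.
move=> lT sT pT; set a := rdot (T u) u; set b := rdot (T v) v.
set d := rdot (T u) v.
have key s : 0 <= a + 2 * s * d + s ^+ 2 * b.
  have := pT (u + s%:C *: v).
  rewrite linD// linZ// !(rdotDl, rdotDr, rdotZl, rdotZr) (sT v u) (rdotC v).
  by rewrite -/a -/b -/d (_ : _ + _ = a + 2 * s * d + s ^+ 2 * b)//; ring.
have a0 : 0 <= a by exact: pT.
have b0 : 0 <= b by exact: pT.
have [b_eq0|b_neq0] := eqVneq b 0.
  have [->|d0] := eqVneq d 0; first by rewrite b_eq0 expr0n mulr0.
  have := key (- (a + 1) / (2 * d)); rewrite b_eq0 mulr0 addr0.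
  rewrite (_ : _ + _ = -1); first by rewrite ler0N1.
  by field.
have := key (- d / b).
rewrite (_ : _ + _ = (a * b - d ^+ 2) / b); last by field.
by rewrite pmulr_lge0 ?subr_ge0// invr_gt0 lt_neqAle eq_sym b_neq0.
Qed.

(** By polarization, [rdot (T u) v] is controlled by the values of the form;
    then take [v = T u / k]. *)
Lemma sym_op_bound T k : linear T -> sym T -> 0 <= k ->
  (forall v, `|rdot (T v) v| <= k * rdot v v) -> op_bound k T.
Proof.
move=> lT sT k0 kT.
have pol u v : 4 * rdot (T u) v <= 2 * k * (rdot u u + rdot v v).
  have hp := le_trans (ler_norm _) (kT (u + v)).
  have hm := le_trans (ler_norm _) (kT (u - v)).
  have hm' : - (k * rdot (u - v) (u - v)) <= rdot (T (u - v)) (u - v).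
    by rewrite -lerN2 opprK (le_trans _ (kT (u - v)))// -normrN ler_norm.
  move: hp hm'; rewrite linD// linB//.
  rewrite !(rdotBl, rdotBr, rdotDl, rdotDr) (sT v u) (rdotC v (T u)) (rdotC v u).
  by move=> *; lra.
move=> v; rewrite -ler_sqr ?nnegrE ?mulr_ge0 ?rnorm_ge0// exprMn -!rdotvv.
have [k_eq0|k_neq0] := eqVneq k 0.
  have := pol v (T v); rewrite k_eq0 mulr0 mul0r expr0n mul0r.
  by rewrite pmulr_rle0.
have kp : 0 < k by rewrite lt_neqAle eq_sym k_neq0.
have := pol v ((k^-1)%:C *: T v); rewrite rdotZl !rdotZr => h.
have : k * (4 * (k^-1 * rdot (T v) (T v))) <=
   k * (2 * k * (rdot v v + k^-1 * (k^-1 * rdot (T v) (T v)))).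
  by rewrite ler_wpM2l.
rewrite (_ : k * _ = 4 * rdot (T v) (T v)); last by field.
rewrite (_ : k * _ = 2 * (k ^+ 2 * rdot v v) + 2 * rdot (T v) (T v)); last first.
  by field.
lra.
Qed.

Lemma op_bound_form T k v : op_bound k T -> `|rdot (T v) v| <= k * rdot v v.
Proof.
move=> Tk; rewrite ler_norml; apply/andP; split.
  rewrite lerNl -rdotNl (le_trans (rdot_norm _ _))// rnormN.
  by rewrite rdotvv expr2 mulrA ler_wpM2r ?rnorm_ge0.
rewrite (le_trans (rdot_norm _ _))//.
by rewrite rdotvv expr2 mulrA ler_wpM2r ?rnorm_ge0.
Qed.

End SymmetricOperators.

(** * Neumann series and inversion of coercive operators *)

Section Completeness.
Variables (R : realType) (H : hilbertType R).

Lemma geometric_small (q e : R) : 0 <= q < 1 -> 0 < e ->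
  exists N, forall n, (N <= n)%N -> q ^+ n <= e.
Proof.
move=> /andP[q0 q1] e0.
have /cvgrPdist_le/(_ e e0)[N _ hN] : (fun n => q ^+ n) @ \oo --> (0 : R).
  by apply: cvg_expr; rewrite ger0_norm.
exists N => n Nn; have := hN n Nn.
by rewrite /= sub0r normrN ger0_norm// exprn_ge0.
Qed.

Lemma hilbert_cauchy_cvg (u : nat -> H) :
  (forall e : R, 0 < e -> exists N, forall n m, (N <= n)%N -> (N <= m)%N ->
     rnorm (u n - u m) <= e) ->
  exists l : H, forall e : R, 0 < e -> exists N, forall n, (N <= n)%N ->
     rnorm (l - u n) <= e.
Proof.
move=> cu.
have pos_real (e : R[i]) : 0 < e -> 0 < complex.Re e /\ e = (complex.Re e)%:C.
  by rewrite ltcE; case: e => a b /= /andP[/eqP-> ->].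
have /cauchy_cvg/cvg_ex[/= l ul] : cauchy (u @ \oo).
  apply/cauchyP => e /pos_real[e0 eE].
  have [|N hN] := cu (complex.Re e / 2); first by rewrite divr_gt0.
  exists (u N); exists N => // n /= Nn; rewrite -ball_normE /= normE eE ltcR.
  apply: le_lt_trans (hN N n _ Nn) _ => //.
  by rewrite ltr_pdivrMr// ltr_pMr// ltr1n.
exists l => e e0.
have [|N _ hN] := (cvgrPdist_le _ _).1 ul e%:C; first by rewrite ltcR.
by exists N => n Nn; rewrite -lecR -normE; exact: hN.
Qed.

Lemma small_norm_eq0 (x : H) : (forall e : R, 0 < e -> rnorm x <= e) -> x = 0.
Proof.
move=> h; apply/eqP; rewrite -rnorm_eq0 eq_le rnorm_ge0 andbT.
by apply/ler_addgt0Pr => e e0; rewrite add0r; exact: h.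
Qed.

End Completeness.

Section Invertibility.
Variables (R : realType) (H : hilbertType R).
Implicit Types (A B T : H -> H) (u v : H).

Lemma bounded_comp A B : bounded_op A -> bounded_op B -> bounded_op (A \o B).
Proof.
move=> [lA cA] [lB cB]; split; first by move=> a u v; rewrite /= lB lA.
by move=> x; apply: continuous_comp; [exact: cB|exact: cA].
Qed.

Lemma invertible_comp A B : invertible_op A -> invertible_op B ->
  invertible_op (A \o B).
Proof.
move=> [A' [bA' AK A'K]] [B' [bB' BK B'K]]; exists (B' \o A').
split; first exact: bounded_comp.
  by move=> v /=; rewrite AK BK.
by move=> v /=; rewrite B'K A'K.
Qed.

(** The inverse [P] of the product commutes with [S], hence [T P] is a two-sided
    inverse of [S]. *)
Lemma invertible_factor S T : bounded_op S -> bounded_op T ->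
  (forall v, S (T v) = T (S v)) -> invertible_op (S \o T) -> invertible_op S.
Proof.
move=> bS bT ST [P [bP PK KP]].
have SP v : S (P v) = P (S v).
  by rewrite -[in RHS](KP v) /= [in X in P (S X)]ST; exact/esym/(PK (S (P v))).
exists (T \o P); split; first exact: bounded_comp.
  by move=> v /=; rewrite -SP -ST; exact: KP.
by move=> v /=; exact: KP.
Qed.

Lemma invertible_below A (c : R) : linear A -> 0 < c ->
  (forall v, c * rnorm v <= rnorm (A v)) ->
  (forall y, exists x, A x = y) -> invertible_op A.
Proof.
move=> lA c0 low surj; have [g Ag] := choice surj.
have inj u v : A u = A v -> u = v.
  move=> uv; apply/eqP; rewrite -subr_eq0 -rnorm_eq0 eq_le rnorm_ge0 andbT.
  have := low (u - v); rewrite linB// uv subrr /rnorm normr0 /=.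
  by rewrite pmulr_rle0.
exists g; split=> [|v|v]; [|exact: inj|exact: Ag].
apply/bounded_opP; split; first by move=> a u v; apply: inj; rewrite lA !Ag.
by exists c^-1 => v; rewrite mulrC ler_pdivlMr// mulrC -{2}(Ag v).
Qed.

(** The solution of [x - T x = y] is the limit of the Picard iterates of
    [x |-> T x + y]. *)
Lemma neumann T (q : R) : linear T -> q < 1 -> op_bound q T ->
  invertible_op (fun v => v - T v).
Proof.
move=> lT q1 qT.
wlog q0 : q q1 qT / 0 <= q.
  move=> h; have [/h|q0] := leP 0 q; first exact.
  apply: (h 0) => // v; rewrite mul0r (le_trans (qT v))//.
  by rewrite nmulr_rle0 ?rnorm_ge0.
have r0 : 0 < 1 - q by rewrite subr_gt0.
have low v : (1 - q) * rnorm v <= rnorm (v - T v).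
  have := rnormD (v - T v) (T v); rewrite subrK => h.
  by have := qT v; lra.
have surj y : exists x, x - T x = y.
  pose u n := iter n (fun x => T x + y) 0.
  have uS k : u k.+1 = T (u k) + y by [].
  have du n : rnorm (u n.+1 - u n) <= q ^+ n * rnorm y.
    elim: n => [|n ih].
      by rewrite /u /= lin0// add0r subr0 expr0 mul1r.
    rewrite exprS -mulrA.
    have -> : u n.+2 - u n.+1 = T (u n.+1 - u n).
      by rewrite [u n.+2]uS [X in _ - X]uS opprD addrACA subrr addr0 -linB.
    by apply: le_trans (qT _) _; rewrite ler_wpM2l.
  have cu n k : rnorm (u (k + n)%N - u n) <= q ^+ n * (rnorm y / (1 - q)).
    have : rnorm (u (k + n)%N - u n) <=
           (q ^+ n - q ^+ (k + n)) * (rnorm y / (1 - q)).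
      elim: k => [|k ih]; first by rewrite add0n !subrr mul0r /rnorm normr0.
      have := rnormD (u (k.+1 + n)%N - u (k + n)%N) (u (k + n)%N - u n).
      rewrite addrA subrK => /le_trans; apply.
      apply: le_trans (lerD (du _) ih) _.
      rewrite le_eqVlt; apply/orP; left; apply/eqP.
      by rewrite addSn exprS; field; rewrite gt_eqF.
    move=> /le_trans; apply; rewrite ler_wpM2r//.
      by rewrite divr_ge0 ?rnorm_ge0 ?ltW.
    by rewrite gerBl exprn_ge0.
  have [|l hl] := @hilbert_cauchy_cvg R H u.
    move=> e e0; pose C := 2 * (rnorm y / (1 - q)) + 1.
    have C0 : 0 < C by rewrite ltr_wpDl// mulr_ge0// divr_ge0 ?rnorm_ge0 ?ltW.
    have [||N hN] := @geometric_small R q (e / C).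
    - by rewrite q0 q1.
    - by rewrite divr_gt0.
    exists N => n m Nn Nm.
    have := rnormD (u n - u N) (u N - u m); rewrite addrA subrK => /le_trans; apply.
    rewrite (rnormB (u N)).
    have := cu N (n - N)%N; have := cu N (m - N)%N; rewrite !subnK// => h1 h2.
    apply: le_trans (lerD h2 h1) _.
    have : q ^+ N * C <= e by rewrite -ler_pdivlMr//; exact: hN.
    apply: le_trans; rewrite /C mulrDr mulr1.
    by have := exprn_ge0 N q0; lra.
  exists l; apply/eqP; rewrite -subr_eq0; apply/eqP.
  apply: small_norm_eq0 => e e0.
  have [|N hN] := hl (e / 2); first by rewrite divr_gt0.
  have -> : l - T l - y = (l - u N.+1) - T (l - u N).
    rewrite linB// uS -!addrA -!opprD; congr (_ - _).
    by rewrite (addrC (T (u N))) addrACA subrr addr0 addrC.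
  rewrite (le_trans (rnormD _ _))// rnormN (splitr e) lerD ?hN//.
  apply: le_trans (qT _) _; apply: le_trans (hN N (leqnn N)).
  by rewrite ler_piMl ?rnorm_ge0// ltW.
apply: (@invertible_below _ (1 - q)) => //.
by move=> a u v; rewrite lT scalerBr opprD addrACA.
Qed.

Lemma invertible_scale A (c : R) : linear A -> c != 0 -> invertible_op A ->
  invertible_op (fun v => c%:C *: A v).
Proof.
move=> lA c0 [P [bP PK KP]]; exists (fun v => P (c^-1%:C *: v)).
have cc : c%:C * c^-1%:C = 1 :> R[i] by rewrite -rcM mulfV.
split=> [|v|v].
- have /bounded_opP[lP [k kP]] := bP; apply/bounded_opP; split.
    by move=> a u v; rewrite scalerDr !scalerA mulrC -scalerA lP.
  by exists (k * `|c^-1|) => v; rewrite -mulrA -rnormZ; exact: kP.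
- by rewrite scalerA mulrC cc scale1r PK.
by rewrite KP scalerA cc scale1r.
Qed.

(** [S = M (1 - (1 - S/M))], and the symmetric operator [1 - S/M] has norm at
    most [1 - c/M]. *)
Lemma invertible_pos S (c : R) : bounded_op S -> sym S -> 0 < c ->
  (forall v, c * rdot v v <= rdot (S v) v) -> invertible_op S.
Proof.
move=> /bounded_opP[lS /bddP[M M0 SM]] sS c0 cS.
have lT : linear (fun v => v - (M^-1)%:C *: S v).
  move=> a u v; rewrite lS scalerBr scalerDr opprD addrACA.
  by rewrite !scalerA mulrC.
have : invertible_op (fun v => v - (v - (M^-1)%:C *: S v)).
  apply: (@neumann _ (Num.max 0 (1 - M^-1 * c))) => //.
    by rewrite gt_max ltr01 gtrBl mulr_gt0 ?invr_gt0.
  apply: sym_op_bound => //.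
  - by move=> u v; rewrite rdotBl rdotBr rdotZl rdotZr sS.
  - by rewrite le_max lexx.
  move=> v; rewrite rdotBl rdotZl ger0_norm.
    apply: le_trans (_ : _ <= (1 - M^-1 * c) * rdot v v) _.
      by rewrite mulrBl mul1r lerD2l lerN2 -mulrA ler_wpM2l ?cS// invr_ge0 ltW.
    by rewrite ler_wpM2r ?rdot_ge0// le_max lexx orbT.
  rewrite subr_ge0 mulrC ler_pdivrMr// mulrC.
  exact: le_trans (ler_norm _) (op_bound_form _ SM).
have -> : (fun v => v - (v - (M^-1)%:C *: S v)) = fun v => (M^-1)%:C *: S v.
  by apply: funext => v; rewrite opprB addrCA subrr addr0.
have lS' : linear (fun v => (M^-1)%:C *: S v).
  by move=> a u v; rewrite lS scalerDr !scalerA mulrC.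
move=> /(invertible_scale lS' (lt0r_neq0 M0)); congr invertible_op.
by apply: funext => v; rewrite scalerA -rcM mulfV ?gt_eqF// scale1r.
Qed.

End Invertibility.

(** * The spectrum of a symmetric operator *)

Section SpectrumSymmetric.
Variables (R : realType) (H : hilbertType R).
Implicit Types (A B S T : H -> H) (u v : H) (z : R[i]).

Lemma bounded_shift A z : bounded_op A -> bounded_op (fun v => A v - z *: v).
Proof.
move=> /bounded_opP[lA [k kA]]; apply/bounded_opP; split.
  by move=> a u v; rewrite lA !scalerDr !scalerN !scalerA mulrC opprD addrACA.
exists (k + complex.Re `|z|) => v; apply: le_trans (rnormD _ _) _.
rewrite rnormN mulrDl lerD//.
by rewrite -lecR rcM -!normE normrZ RRe_real ?normr_real.
Qed.

(** [(B - ib) (B + ib) = B^2 + b^2] is coercive, and the factors commute. *)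
Lemma invertible_sym_imag B (b : R) : bounded_op B -> sym B -> b != 0 ->
  invertible_op (fun v => B v - (b%:C * 'i) *: v).
Proof.
move=> bB sB b0; have /bounded_opP[lB _] := bB.
set j : R[i] := b%:C * 'i.
have jj : j * j = - (b ^+ 2)%:C by rewrite /j; simpc; rewrite expr2.
have ST v : B (B v + j *: v) - j *: (B v + j *: v) = B (B v) + (b ^+ 2)%:C *: v.
  rewrite linD// linZ// scalerDr scalerA jj scaleNr opprD opprK addrA.
  by rewrite addrK.
have TS v : B (B v - j *: v) + j *: (B v - j *: v) = B (B v) + (b ^+ 2)%:C *: v.
  rewrite (linB _ _ lB) (linZ _ _ lB) scalerBr scalerA jj scaleNr opprK addrA.
  by rewrite subrK.
apply: (@invertible_factor _ _ _ (fun v => B v - (- j) *: v)).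
- exact: bounded_shift.
- exact: bounded_shift.
- by move=> v; rewrite !scaleNr !opprK ST TS.
rewrite (_ : _ \o _ = fun v => B (B v) + (b ^+ 2)%:C *: v); last first.
  by apply: funext => v; rewrite /= scaleNr opprK ST.
apply: (@invertible_pos _ _ _ (b ^+ 2)).
- have := bounded_shift (- (b ^+ 2)%:C) (bounded_comp bB bB).
  by congr bounded_op; apply: funext => v; rewrite /= scaleNr opprK.
- by move=> u v; rewrite rdotDl rdotDr rdotZl rdotZr !sB.
- by rewrite exprn_even_gt0.
by move=> v; rewrite rdotDl rdotZl lerDr sB rdot_ge0.
Qed.

Lemma sym_shift A (a : R) : sym A -> sym (fun v => A v - a%:C *: v).
Proof. by move=> sA u v; rewrite rdotBl rdotBr rdotZl rdotZr sA. Qed.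

Lemma sym_spectrum_real A z : bounded_op A -> sym A -> spectrum A z ->
  z = (complex.Re z)%:C.
Proof.
move=> bA sA; case: z => a b /= Az; have [->//|b0] := eqVneq b 0.
exfalso; apply: Az.
have := invertible_sym_imag (bounded_shift a%:C bA) (sym_shift a sA) b0.
congr invertible_op; apply: funext => v.
rewrite -addrA -opprD -scalerDl; congr (_ - _ *: _).
by simpc.
Qed.

(** Cauchy-Schwarz for the form of [S], at [v] and [S v], gives
    [|S v|^2 <= M rdot (S v) v], while [|v|] is bounded by a multiple of [|S v|]. *)
Lemma pos_invertible_below S : bounded_op S -> sym S ->
  (forall v, 0 <= rdot (S v) v) -> invertible_op S ->
  exists2 c : R, 0 < c & forall v, c * rdot v v <= rdot (S v) v.
Proof.
move=> /bounded_opP[lS /bddP[M M0 SM]] sS pS [P [bP PK _]].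
have /bounded_opP[_ /bddP[k k0 kP]] := bP.
exists (k ^+ 2 * M)^-1 => [|v]; first by rewrite invr_gt0 mulr_gt0// exprn_gt0.
rewrite mulrC ler_pdivrMr ?mulr_gt0// ?exprn_gt0//.
have vn : rdot v v <= k ^+ 2 * rdot (S v) (S v).
  rewrite !rdotvv -exprMn ler_sqr ?nnegrE ?mulr_ge0 ?rnorm_ge0 ?(ltW k0)//.
  by have := kP (S v); rewrite PK.
apply: le_trans vn _; rewrite (mulrC (rdot (S v) v)) -[leRHS]mulrA ler_wpM2l ?sqr_ge0//.
have cs := form_cauchy_schwarz v (S v) lS sS pS.
have bd : rdot (S (S v)) (S v) <= M * rdot (S v) (S v).
  exact: le_trans (ler_norm _) (op_bound_form _ SM).
have [n0|n0] := eqVneq (rdot (S v) (S v)) 0.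
  by rewrite n0 mulr_ge0 ?pS ?ltW.
have np : 0 < rdot (S v) (S v) by rewrite lt_neqAle eq_sym n0 rdot_ge0.
rewrite -(ler_pM2r np) -expr2 (le_trans cs)//.
by rewrite (mulrC M) -[leRHS]mulrA ler_wpM2l.
Qed.

(** For the infimum [m] of the form on unit vectors, [A - m] is nonnegative; were
    it invertible, it would be coercive and [m] would not be the infimum. *)
Lemma inf_form_spectrum A : bounded_op A -> sym A -> (exists v : H, v != 0) ->
  exists m : R, spectrum A m%:C /\ forall v, m * rdot v v <= rdot (A v) v.
Proof.
move=> bA sA [v0 v0n].
have /bounded_opP[lA /bddP[M M0 AM]] := bA.
pose E := [set c : R | forall v, c * rdot v v <= rdot (A v) v].
have EM : E (- M).
  move=> v; have := op_bound_form v AM; rewrite ler_norml mulNr => /andP[h _].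
  exact: h.
have p0 : 0 < rdot v0 v0 by rewrite lt_neqAle eq_sym rdot_eq0 v0n rdot_ge0.
have hE : has_sup E.
  split; first by exists (- M).
  exists (rdot (A v0) v0 / rdot v0 v0) => c Ec.
  by rewrite ler_pdivlMr//; exact: Ec.
have Em : E (sup E).
  move=> v; have [->|vn] := eqVneq v 0; first by rewrite !rdot0r mulr0.
  have pv : 0 < rdot v v by rewrite lt_neqAle eq_sym rdot_eq0 vn rdot_ge0.
  rewrite -ler_pdivlMr//; apply: ge_sup; first by exists (- M).
  by move=> c Ec; rewrite ler_pdivlMr//; exact: Ec.
exists (sup E); split=> // inv.
have [|||c c0 hc] := pos_invertible_below _ _ _ inv.
- exact: bounded_shift.
- exact: sym_shift.
- by move=> v; rewrite rdotBl rdotZl subr_ge0; exact: Em.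
have : E (sup E + c).
  by move=> v; have := hc v; rewrite rdotBl rdotZl mulrDl; lra.
by move=> /(ub_le_sup hE.2); rewrite gerDl leNgt c0.
Qed.
End SpectrumSymmetric.

(** * Spectral mapping for polynomials *)

Section PolynomialsOfOperators.
Variables (R : realType) (H : hilbertType R).
Implicit Types (A B : H -> H) (u v : H) (p q : {poly R[i]}).

(** Complex coefficients, because real polynomials factor into degree one
    polynomials only over [R[i]]. *)
Definition cpoly_op p A : H -> H :=
  fun v => \sum_(i < size p) p`_i *: iter i A v.

Lemma cpoly_op_wide n p A v : (size p <= n)%N ->
  cpoly_op p A v = \sum_(i < n) p`_i *: iter i A v.
Proof.
move=> pn; rewrite /cpoly_op (big_ord_widen n (fun i => p`_i *: iter i A v))//.
rewrite big_mkcond; apply: eq_bigr => i _; case: ltnP => // pi.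
by rewrite nth_default// scale0r.
Qed.

Lemma poly_op_complex (p : {poly R}) A :
  poly_op p A = cpoly_op (map_poly (real_complex R) p) A.
Proof.
apply: funext => v; rewrite /poly_op /cpoly_op size_map_poly.
by apply: eq_bigr => i _; rewrite coef_map.
Qed.

Lemma cpoly_opD p q A v : cpoly_op (p + q) A v = cpoly_op p A v + cpoly_op q A v.
Proof.
rewrite (@cpoly_op_wide (maxn (size p) (size q)))//; last exact: size_polyD.
rewrite !(@cpoly_op_wide (maxn (size p) (size q))) ?leq_maxl ?leq_maxr//.
by rewrite -big_split /=; apply: eq_bigr => i _; rewrite coefD scalerDl.
Qed.

Lemma cpoly_opZ c p A v : cpoly_op (c *: p) A v = c *: cpoly_op p A v.
Proof.
rewrite (@cpoly_op_wide (size p)) ?size_scale_leq// scaler_sumr.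
by apply: eq_bigr => i _; rewrite coefZ scalerA.
Qed.

Lemma cpoly_opC c A v : cpoly_op c%:P A v = c *: v.
Proof.
rewrite (@cpoly_op_wide 1) ?size_polyC_leq1//.
by rewrite big_ord_recl big_ord0 addr0 coefC.
Qed.

Lemma cpoly_opMX p A v : cpoly_op (p * 'X) A v = cpoly_op p A (A v).
Proof.
rewrite (@cpoly_op_wide (size p).+1); last first.
  by rewrite (leq_trans (size_polyMleq _ _))// size_polyX addn2.
rewrite big_ord_recl coefMX /= scale0r add0r /cpoly_op.
by apply: eq_bigr => i _; rewrite coefMX -iterSr /=.
Qed.

Lemma cpoly_op_comm p A v : linear A -> cpoly_op p A (A v) = A (cpoly_op p A v).
Proof.
move=> lA; rewrite /cpoly_op lin_sum//; apply: eq_bigr => i _.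
by rewrite (linZ _ _ lA) -iterSr.
Qed.

Lemma cpoly_opM p q A v : linear A ->
  cpoly_op (p * q) A v = cpoly_op p A (cpoly_op q A v).
Proof.
move=> lA; elim/poly_ind: p v => [|p c ih] v.
  by rewrite mul0r /cpoly_op size_poly0 !big_ord0.
rewrite mulrDl -mulrA (mulrC 'X) mulrA !cpoly_opD !cpoly_opMX cpoly_opC ih.
rewrite cpoly_op_comm//; congr (_ + _).
by rewrite mul_polyC cpoly_opZ.
Qed.

Lemma bounded_cpoly_op p A : bounded_op A -> bounded_op (cpoly_op p A).
Proof.
move=> bA; elim/poly_ind: p => [|p c ih].
  apply/bounded_opP; rewrite (_ : cpoly_op 0 A = fun=> 0).
    split=> [a u v|]; first by rewrite scaler0 addr0.
    by exists 0 => v; rewrite mul0r /rnorm normr0.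
  by apply: funext => v; rewrite /cpoly_op size_poly0 big_ord0.
have := bounded_shift (- c) (bounded_comp ih bA).
congr bounded_op; apply: funext => v.
by rewrite cpoly_opD cpoly_opMX cpoly_opC scaleNr opprK.
Qed.

(** No root of [p] is in the spectrum, so the factorization of [p] over [R[i]]
    writes [p(A)] as a product of invertible operators. *)
Lemma invertible_cpoly_op p A : bounded_op A -> p != 0 ->
  (forall z, spectrum A z -> p.[z] != 0) -> invertible_op (cpoly_op p A).
Proof.
move=> bA p0 pA; have [r pE] := closed_field_poly_normal p.
have /bounded_opP[lA _] := bA.
have scal c : c != 0 -> invertible_op (cpoly_op c%:P A).
  move=> c0; exists (cpoly_op (c^-1)%:P A); split=> [|v|v].
  - exact: bounded_cpoly_op.
  - by rewrite !cpoly_opC scalerA mulVf// scale1r.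
  - by rewrite !cpoly_opC scalerA mulfV// scale1r.
have mul q q' : invertible_op (cpoly_op q A) -> invertible_op (cpoly_op q' A) ->
    invertible_op (cpoly_op (q * q') A).
  move=> iq iq'; rewrite (_ : cpoly_op _ _ = cpoly_op q A \o cpoly_op q' A).
    exact: invertible_comp.
  by apply: funext => v; rewrite cpoly_opM.
have rz z : z \in r -> invertible_op (cpoly_op ('X - z%:P) A).
  move=> zr; have : p.[z] == 0.
    rewrite pE hornerZ horner_prod mulf_eq0; apply/orP; right.
    by rewrite prodf_seq_eq0; apply/hasP; exists z => //=; rewrite !hornerE subrr.
  move=> pz; rewrite (_ : cpoly_op _ _ = fun v => A v - z *: v).
    by apply: contrapT => sz; have := pA z sz; rewrite pz.
  apply: funext => v; rewrite cpoly_opD -polyCN cpoly_opC scaleNr.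
  by rewrite -['X]mul1r cpoly_opMX cpoly_opC scale1r.
rewrite pE -mul_polyC; apply: (mul); first by apply: (scal); rewrite lead_coef_eq0.
elim: r rz {pE} => [|z r ih] rz; first by rewrite big_nil; exact: scal (oner_neq0 _).
rewrite big_cons; apply: (mul); first by apply: rz; rewrite mem_head.
by apply: ih => y yr; apply: rz; rewrite inE yr orbT.
Qed.

End PolynomialsOfOperators.

Section RealPolynomials.
Variables (R : realType) (H : hilbertType R).
Implicit Types (A B : H -> H) (u v : H) (p q : {poly R}).

Lemma poly_opD p q A v : poly_op (p + q) A v = poly_op p A v + poly_op q A v.
Proof. by rewrite !poly_op_complex rmorphD cpoly_opD. Qed.

Lemma poly_opC (c : R) A v : poly_op c%:P A v = c%:C *: v.
Proof. by rewrite poly_op_complex map_polyC cpoly_opC. Qed.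

Lemma poly_opMX p A v : poly_op (p * 'X) A v = poly_op p A (A v).
Proof. by rewrite !poly_op_complex rmorphM /= map_polyX cpoly_opMX. Qed.

Lemma poly_opX A v : poly_op 'X A v = A v.
Proof. by rewrite -['X]mul1r poly_opMX poly_opC scale1r. Qed.

Lemma poly_opM p q A v : linear A ->
  poly_op (p * q) A v = poly_op p A (poly_op q A v).
Proof. by move=> lA; rewrite !poly_op_complex rmorphM cpoly_opM. Qed.

Lemma poly_opB p q A v : poly_op (p - q) A v = poly_op p A v - poly_op q A v.
Proof.
rewrite poly_opD; congr (_ + _); rewrite /poly_op size_polyN -sumrN.
by apply: eq_bigr => i _; rewrite coefN rcN scaleNr.
Qed.

Lemma bounded_poly_op p A : bounded_op A -> bounded_op (poly_op p A).
Proof. by move=> bA; rewrite poly_op_complex; exact: bounded_cpoly_op. Qed.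

Lemma sym_poly_op p A : sym A -> linear A -> sym (poly_op p A).
Proof.
move=> sA lA; elim/poly_ind: p => [|p c ih] u v.
  by rewrite /poly_op size_poly0 !big_ord0 rdot0l rdot0r.
rewrite !poly_opD !poly_opMX !poly_opC rdotDl rdotDr rdotZl rdotZr ih sA.
by rewrite !poly_op_complex cpoly_op_comm.
Qed.

Lemma sym_spectrum_neq0 A : bounded_op A -> sym A -> (exists v : H, v != 0) ->
  exists t : R, spectrum A t%:C.
Proof. by move=> bA sA /(inf_form_spectrum bA sA)[m [Am _]]; exists m. Qed.

(** The infimum of the form of [p(A)] is in the spectrum of [p(A)], hence is a
    value of [p] on the spectrum of [A]. *)
Lemma poly_op_ge0 p A : bounded_op A -> sym A ->
  (forall t, spectrum A t%:C -> 0 <= p.[t]) ->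
  forall v, 0 <= rdot (poly_op p A v) v.
Proof.
move=> bA sA pA v; have [->|vn] := eqVneq v 0; first by rewrite rdot0r.
have vex : exists v : H, v != 0 by exists v.
have /bounded_opP[lA _] := bA.
have [m [pm mv]] := inf_form_spectrum (bounded_poly_op p bA) (sym_poly_op p sA lA) vex.
suff [t At pt] : exists2 t, spectrum A t%:C & p.[t] = m.
  by apply: le_trans (mv v); rewrite mulr_ge0 ?rdot_ge0// -pt pA.
have [t0 At0] := sym_spectrum_neq0 bA sA vex.
have [pmE|pmn] := eqVneq (p - m%:P) 0.
  by exists t0 => //; apply/eqP; rewrite -subr_eq0 -[m](hornerC m t0) -hornerN -hornerD pmE horner0.
apply: contrapT => nt; apply: pm.
have -> : (fun v => poly_op p A v - m%:C *: v) =
          cpoly_op (map_poly (real_complex R) (p - m%:P)) A.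
  by apply: funext => x; rewrite -poly_op_complex poly_opB poly_opC.
apply: invertible_cpoly_op => //; first by rewrite map_poly_eq0.
move=> z Az; have zE := sym_spectrum_real bA sA Az.
rewrite zE horner_map /=; apply/negP => /eqP/complexI pz; apply: nt.
exists (complex.Re z); first by rewrite -zE.
by apply/eqP; rewrite -subr_eq0; move: pz; rewrite !hornerE => /eqP.
Qed.

End RealPolynomials.

(** * Continuous functional calculus *)

Section FunctionalCalculus.
Variable R : realType.
Implicit Types (H : hilbertType R) (f g : R -> R) (p q : {poly R}).

(** Only spectral values in [R] matter for bounded symmetric operators, by
    [sym_spectrum_real]; [rspec] below collects them. *)
Definition bsym H (A : H -> H) := bounded_op A /\ sym A.

Definition rspec H (A : H -> H) : set R := [set t | spectrum A t%:C].

Definition poly_approx f (S : set R) := forall e : R, 0 < e ->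
  exists p : {poly R}, forall t, S t -> `|p.[t] - f t| <= e.

Lemma bsym_lin H (A : H -> H) : bsym A -> linear A.
Proof. by move=> [/bounded_opP[]]. Qed.

Lemma bsym_bdd H (A : H -> H) : bsym A -> bdd A.
Proof. by move=> [/bounded_opP[]]. Qed.

Lemma bsym_poly H (A : H -> H) p : bsym A -> bsym (poly_op p A).
Proof.
move=> bA; split; first exact: bounded_poly_op bA.1.
by apply: sym_poly_op; [exact: bA.2|exact: bsym_lin].
Qed.

Lemma poly_approx_sub f S S' : S `<=` S' -> poly_approx f S' -> poly_approx f S.
Proof.
by move=> SS' fS e /fS[p pf]; exists p => t St; apply: pf; exact: SS'.
Qed.

(** The form in which all limits of the functional calculus are taken. *)
Lemma le0_small_mul (x C : R) : (forall e, 0 < e -> x <= e * C) -> x <= 0.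
Proof.
move=> h; have C0 : 0 < `|C| + 1 by rewrite ltr_wpDl.
apply/ler_addgt0Pr => e e0; rewrite add0r.
apply: le_trans (h (e / (`|C| + 1)) _) _; first by rewrite divr_gt0.
rewrite -mulrA ler_piMr ?(ltW e0)// mulrC ler_pdivrMr// mul1r.
by rewrite (le_trans (ler_norm _))// lerDl.
Qed.

Lemma is_fcalcP H f (A B : H -> H) : is_fcalc f A B <->
  bounded_op B /\ forall e : R, 0 < e -> exists p,
    (forall t, rspec A t -> `|p.[t] - f t| <= e) /\
    op_bound e (fun v => poly_op p A v - B v).
Proof.
split=> -[bB h]; split=> // e /h[p [pf pB]]; exists p; split=> // v.
  by have := pB v; rewrite !normE -rcM lecR.
by have := pB v; rewrite !normE -rcM lecR.
Qed.

Lemma is_fcalc_approx H f (A B : H -> H) : is_fcalc f A B -> poly_approx f (rspec A).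
Proof. by move=> /is_fcalcP[_ h] e /h[p [pf _]]; exists p. Qed.

Lemma is_fcalc_lin H f (A B : H -> H) : is_fcalc f A B -> linear B.
Proof. by move=> [/bounded_opP[]]. Qed.

(** Both [e + p(A)] and [e - p(A)] are nonnegative by [poly_op_ge0]. *)
Lemma poly_op_bound H (A : H -> H) p (e : R) : bsym A -> 0 <= e ->
  (forall t, rspec A t -> `|p.[t]| <= e) -> op_bound e (poly_op p A).
Proof.
move=> bA e0 pe; have [bp sp] := bsym_poly p bA.
apply: sym_op_bound => //; first by have /bounded_opP[] := bp.
move=> v; rewrite ler_norml; apply/andP; split.
  have := @poly_op_ge0 _ _ (p + e%:P) A bA.1 bA.2 _ v.
  rewrite poly_opD poly_opC rdotDl rdotZl -lerBlDr sub0r; apply=> t At.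
  by have := pe t At; rewrite !hornerE ler_norml => /andP[]; lra.
have := @poly_op_ge0 _ _ (e%:P - p) A bA.1 bA.2 _ v.
rewrite poly_opB poly_opC rdotBl rdotZl subr_ge0; apply=> t At.
by have := pe t At; rewrite !hornerE ler_norml => /andP[]; lra.
Qed.

Lemma is_fcalc_near H f (A B : H -> H) p (e : R) : bsym A -> is_fcalc f A B ->
  0 <= e -> (forall t, rspec A t -> `|p.[t] - f t| <= e) ->
  op_bound e (fun v => poly_op p A v - B v).
Proof.
move=> bA /is_fcalcP[_ fB] e0 pf v; rewrite -subr_le0.
apply: (@le0_small_mul _ (2 * rnorm v)) => d d0.
have [q [qf qB]] := fB d d0.
have pq : op_bound (e + d) (poly_op (p - q) A).
  apply: poly_op_bound => //; first by rewrite addr_ge0// ltW.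
  move=> t At; rewrite !hornerE -(subrKA (f t)).
  rewrite (le_trans (ler_normD _ _))// lerD ?pf// distrC; exact: qf.
have := rnormD (poly_op (p - q) A v) (poly_op q A v - B v).
rewrite {1}poly_opB subrKA => h.
by have := pq v; have := qB v; lra.
Qed.

Lemma is_fcalc_sym H f (A B : H -> H) : bsym A -> is_fcalc f A B -> sym B.
Proof.
move=> bA /is_fcalcP[_ fB].
have le u v : rdot (B u) v - rdot u (B v) <= 0.
  apply: (@le0_small_mul _ (2 * (rnorm u * rnorm v))) => e e0.
  have [p [_ pB]] := fB e e0.
  have -> : rdot (B u) v - rdot u (B v) =
     rdot (- (poly_op p A u - B u)) v + rdot u (poly_op p A v - B v).
    rewrite rdotNl rdotBl rdotBr -(bsym_poly p bA).2; ring.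
  have h1 := rdot_norm (- (poly_op p A u - B u)) v.
  have h2 := rdot_norm u (poly_op p A v - B v).
  have h3 : rnorm (- (poly_op p A u - B u)) * rnorm v <= e * rnorm u * rnorm v.
    by rewrite rnormN ler_wpM2r ?rnorm_ge0.
  have h4 : rnorm u * rnorm (poly_op p A v - B v) <= rnorm u * (e * rnorm v).
    by rewrite ler_wpM2l ?rnorm_ge0.
  by move: h1 h2 h3 h4; rewrite -(mulrA e) (mulrCA (rnorm u)); lra.
move=> u v; apply/eqP; rewrite eq_le -subr_le0 le/= -subr_le0.
by have := le v u; rewrite (rdotC (B v)) (rdotC v).
Qed.

Lemma is_fcalc_bsym H f (A B : H -> H) : bsym A -> is_fcalc f A B -> bsym B.
Proof. by move=> bA fB; split; [exact: fB.1|exact: is_fcalc_sym fB]. Qed.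

(** If [p n] approximates [f] on the spectrum, then [p n (A)] is a Cauchy sequence
    in operator norm by [poly_op_bound]; its pointwise limit is [f(A)]. *)
Lemma is_fcalc_exists H f (A : H -> H) : bsym A -> poly_approx f (rspec A) ->
  exists B, is_fcalc f A B.
Proof.
move=> bA fA; pose e n : R := n.+1%:R^-1.
have e_gt0 n : 0 < e n by rewrite invr_gt0.
have e_small (d : R) : 0 < d -> exists N, forall n, (N <= n)%N -> e n <= d.
  move=> d0; exists (Num.bound d^-1) => n Nn.
  rewrite /e invf_ple ?posrE//; apply: ltW.
  apply: lt_le_trans (archi_boundP _) _; first by rewrite invr_ge0 ltW.
  by rewrite ler_nat ltnW.
have /choice[p pf] : forall n, exists p : {poly R},
    forall t, rspec A t -> `|p.[t] - f t| <= e n.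
  by move=> n; exact: fA.
have pp n m : op_bound (e n + e m) (fun v => poly_op (p n) A v - poly_op (p m) A v).
  have := @poly_op_bound _ A (p n - p m) (e n + e m) bA.
  rewrite addr_ge0 ?ltW// => /(_ isT) h v; rewrite -poly_opB; apply: h => t At.
  rewrite !hornerE -(subrKA (f t)).
  by rewrite (le_trans (ler_normD _ _))// lerD ?pf// distrC; exact: pf.
have /choice[B hB] : forall v : H, exists l : H, forall d : R, 0 < d ->
    exists N, forall n, (N <= n)%N -> rnorm (l - poly_op (p n) A v) <= d.
  move=> v; apply: hilbert_cauchy_cvg => d d0.
  pose C := 2 * rnorm v + 1.
  have C0 : 0 < C by rewrite ltr_wpDl// mulr_ge0// rnorm_ge0.
  have [|N hN] := e_small (d / C); first by rewrite divr_gt0.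
  exists N => n m Nn Nm; apply: le_trans (pp n m v) _.
  have := hN n Nn; have := hN m Nm; rewrite !ler_pdivlMr// /C.
  by have := rnorm_ge0 v; have := e_gt0 n; have := e_gt0 m; nra.
have pB n : op_bound (e n) (fun v => poly_op (p n) A v - B v).
  move=> v; rewrite -subr_le0; apply: (@le0_small_mul _ (rnorm v + 1)) => d d0.
  have [N1 h1] := hB v d d0; have [N2 h2] := e_small d d0.
  pose m := maxn N1 N2.
  have := h1 m (leq_maxl _ _); have := h2 m (leq_maxr _ _); rewrite rnormB => h3 h4.
  have := rnormD (poly_op (p n) A v - poly_op (p m) A v) (poly_op (p m) A v - B v).
  rewrite subrKA; have := pp n m v; have := rnorm_ge0 v; nra.
have lB : linear B.
  move=> a u v; apply/eqP; rewrite -subr_eq0 -rnorm_eq0 eq_le rnorm_ge0 andbT.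
  set C := rnorm (a *: u + v) + (complex.Re `|a| * rnorm u + rnorm v).
  apply: (@le0_small_mul _ C) => d d0.
  have [N /(_ N (leqnn N)) eN] := e_small d d0.
  have lp := bsym_lin (bsym_poly (p N) bA).
  set P := poly_op (p N) A in lp *.
  have -> : B (a *: u + v) - (a *: B u + B v) =
    - (P (a *: u + v) - B (a *: u + v)) + (a *: (P u - B u) + (P v - B v)).
    have -> : a *: (P u - B u) + (P v - B v) = P (a *: u + v) - (a *: B u + B v).
      by rewrite scalerBr addrACA -opprD lp.
    by rewrite opprB subrKA.
  have h1 := pB N (a *: u + v); have h2 := pB N u; have h3 := pB N v.
  have aE : rnorm (a *: (P u - B u)) = complex.Re `|a| * rnorm (P u - B u).
    by apply: complexI; rewrite rcM -!normE normrZ RRe_real ?normr_real.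
  have a0 : 0 <= complex.Re `|a| by rewrite -ler0c RRe_real ?normr_real.
  apply: le_trans (rnormD _ _) _; rewrite rnormN.
  have h4 := rnormD (a *: (P u - B u)) (P v - B v).
  rewrite aE in h4; rewrite -/P in h1 h2 h3.
  have h5 : complex.Re `|a| * rnorm (P u - B u) <= complex.Re `|a| * (d * rnorm u).
    rewrite ler_wpM2l//; apply: le_trans h2 _; rewrite ler_wpM2r ?rnorm_ge0//.
  have h6 : e N * rnorm v <= d * rnorm v by rewrite ler_wpM2r ?rnorm_ge0.
  have h7 : e N * rnorm (a *: u + v) <= d * rnorm (a *: u + v).
    by rewrite ler_wpM2r ?rnorm_ge0.
  by rewrite /C; lra.
exists B; apply/is_fcalcP; split.
  apply/bounded_opP; split=> //.
  have /bounded_opP[_ [k kP]] := (bsym_poly (p 0%N) bA).1.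
  exists (k + e 0%N) => v; have := rnormD (poly_op (p 0%N) A v) (B v - poly_op (p 0%N) A v).
  rewrite addrC subrK rnormB mulrDl => /le_trans; apply.
  by rewrite lerD ?kP ?(pB 0%N v).
move=> d d0; have [N /(_ N (leqnn N)) eN] := e_small d d0.
exists (p N); split=> [t At|v]; first exact: le_trans (pf N t At) eN.
by apply: le_trans (pB N v) _; rewrite ler_wpM2r ?rnorm_ge0.
Qed.

Lemma poly_op_intertwine H H' (A : H -> H) (A' : H' -> H') (W : H -> H') p v :
  linear W -> (forall v, W (A v) = A' (W v)) ->
  W (poly_op p A v) = poly_op p A' (W v).
Proof.
move=> lW WA; elim/poly_ind: p v => [|p c ih] v.
  by rewrite /poly_op size_poly0 !big_ord0 lin0.
by rewrite !poly_opD !poly_opMX !poly_opC linD// linZ// ih WA.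
Qed.

(** Polynomials intertwine, and both calculi are limits along the same
    polynomials. [W = id] gives uniqueness of [f(A)]; embeddings [W] give the
    calculus of block operators. *)
Lemma is_fcalc_intertwine H H' f (A B : H -> H) (A' B' : H' -> H') (W : H -> H') :
  bsym A -> bsym A' -> linear W -> bdd W -> (forall v, W (A v) = A' (W v)) ->
  poly_approx f (rspec A `|` rspec A') -> is_fcalc f A B -> is_fcalc f A' B' ->
  forall v, W (B v) = B' (W v).
Proof.
move=> bA bA' lW /bddP[k k0 kW] WA fAA fB fB' v.
apply/eqP; rewrite -subr_eq0 -rnorm_eq0 eq_le rnorm_ge0 andbT.
apply: (@le0_small_mul _ (k * rnorm v + rnorm (W v))) => e e0.
have [p pf] := fAA e e0.
have h1 : op_bound e (fun v => poly_op p A v - B v).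
  by apply: is_fcalc_near (fB) _ _ => //; [exact: ltW|move=> t At; apply: pf; left].
have h2 : op_bound e (fun v => poly_op p A' v - B' v).
  by apply: is_fcalc_near (fB') _ _ => //; [exact: ltW|move=> t At; apply: pf; right].
have -> : W (B v) - B' (W v) =
   - W (poly_op p A v - B v) + (poly_op p A' (W v) - B' (W v)).
  by rewrite (linB _ _ lW) opprB (poly_op_intertwine _ _ lW WA) subrKA.
apply: le_trans (rnormD _ _) _; rewrite rnormN mulrDr lerD//.
apply: le_trans (kW _) _; rewrite mulrCA ler_wpM2l ?(ltW k0)//; exact: h1.
Qed.

Lemma is_fcalc_unique H f (A B B' : H -> H) : bsym A ->
  is_fcalc f A B -> is_fcalc f A B' -> B = B'.
Proof.
move=> bA fB fB'; apply: funext => v.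
apply: (is_fcalc_intertwine (W := id) bA bA _ _ _ _ fB fB') => //.
  by exists 1 => u; rewrite mul1r.
by rewrite setUid; exact: is_fcalc_approx fB.
Qed.

Lemma fcalcP H f (A : H -> H) : bsym A -> poly_approx f (rspec A) ->
  is_fcalc f A (fcalc f A).
Proof.
move=> bA fA; have [B fB] := is_fcalc_exists bA fA.
exact: (xgetI _ fB).
Qed.

Lemma fcalcE H f (A B : H -> H) : bsym A -> is_fcalc f A B -> fcalc f A = B.
Proof.
move=> bA fB; apply: is_fcalc_unique (fB) => //.
by apply: fcalcP => //; exact: is_fcalc_approx fB.
Qed.

Lemma is_fcalc_ext H f g (A B : H -> H) :
  (forall t, rspec A t -> f t = g t) -> is_fcalc f A B -> is_fcalc g A B.
Proof.
move=> fg [bB h]; split=> // e /h[p [pf pB]]; exists p; split=> // t At.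
by rewrite -fg//; exact: pf.
Qed.

Lemma is_fcalc_poly H (A : H -> H) p : bsym A ->
  is_fcalc (horner p) A (poly_op p A).
Proof.
move=> bA; apply/is_fcalcP; split; first exact: bounded_poly_op bA.1.
move=> e e0; exists p; split=> [t _|v]; first by rewrite subrr normr0 ltW.
by rewrite subrr rnorm0 mulr_ge0 ?rnorm_ge0// ltW.
Qed.

End FunctionalCalculus.

(** * Rules of the functional calculus *)

Section CalculusRules.
Variables (R : realType) (H : hilbertType R).
Implicit Types (A B C : H -> H) (f g : R -> R) (p q : {poly R}).

Lemma rspec_le A (k : R) : bsym A -> (forall v, rdot (A v) v <= k * rdot v v) ->
  forall t, rspec A t -> t <= k.
Proof.
move=> bA Ak t At; rewrite leNgt; apply/negP => kt; apply: At.
have /bounded_opP[lB [l lBd]] := bounded_shift t%:C bA.1.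
have : invertible_op (fun v => - (A v - t%:C *: v)).
  apply: (@invertible_pos _ _ _ (t - k)).
  - apply/bounded_opP; split; first by move=> a u v; rewrite lB opprD scalerN.
    by exists l => v; rewrite rnormN; exact: lBd.
  - by move=> u v; rewrite rdotNl rdotNr (sym_shift _ bA.2).
  - by rewrite subr_gt0.
  by move=> v; rewrite rdotNl rdotBl rdotZl opprB mulrBl lerD2l lerN2.
have lN : linear (fun v => - (A v - t%:C *: v)).
  by move=> a u v; rewrite lB opprD scalerN.
move=> /(invertible_scale lN (c := -1)); rewrite oppr_eq0 oner_eq0 => /(_ isT).
congr invertible_op; apply: funext => v.
by rewrite rcN scaleNr scale1r opprK.
Qed.

Lemma rspec_ge A (k : R) : bsym A -> (forall v, k * rdot v v <= rdot (A v) v) ->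
  forall t, rspec A t -> k <= t.
Proof.
move=> bA Ak t At; rewrite leNgt; apply/negP => kt; apply: At.
apply: (@invertible_pos _ _ _ (k - t)).
- exact: bounded_shift bA.1.
- exact: sym_shift bA.2.
- by rewrite subr_gt0.
by move=> v; rewrite rdotBl rdotZl mulrBl lerD2r.
Qed.

Lemma rspec_bounded A : bsym A -> exists2 M : R, 0 < M &
  forall t, rspec A t -> `|t| <= M.
Proof.
move=> bA; have [M M0 AM] := bddP (bsym_bdd bA); exists M => // t At.
have hM v := op_bound_form v AM.
rewrite ler_norml (@rspec_ge A _ bA _ t At) ?(@rspec_le A _ bA _ t At)//.
  by move=> v; exact: le_trans (ler_norm _) (hM v).
by move=> v; have := hM v; rewrite ler_norml mulNr => /andP[].
Qed.

(** [f] is within [1] of a polynomial on the bounded set [rspec A]. *)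
Lemma is_fcalc_bounded A f B : bsym A -> is_fcalc f A B ->
  exists2 F : R, 0 < F & forall t, rspec A t -> `|f t| <= F.
Proof.
move=> bA /is_fcalcP[_ /(_ 1 ltr01)[p [pf _]]].
have [M M0 AM] := rspec_bounded bA.
suff [F F0 pF] : exists2 F : R, 0 <= F & forall t, `|t| <= M -> `|p.[t]| <= F.
  exists (F + 1) => [|t At]; first by rewrite ltr_wpDl.
  have := ler_normD (p.[t]) (f t - p.[t]); rewrite addrC subrK distrC => h.
  by apply: le_trans h _; rewrite lerD ?pf ?pF ?AM.
elim/poly_ind: p {pf} => [|p c [F F0 pF]].
  by exists 0 => // t _; rewrite horner0 normr0.
exists (F * M + `|c|) => [|t tM]; first by rewrite addr_ge0 ?mulr_ge0 ?(ltW M0).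
rewrite !hornerE (le_trans (ler_normD _ _))// lerD2r normrM.
by rewrite ler_pM ?pF.
Qed.

Lemma is_fcalc_add A f g B C : is_fcalc f A B -> is_fcalc g A C ->
  bsym A -> is_fcalc (fun t => f t + g t) A (fun v => B v + C v).
Proof.
move=> fB gC bA.
have /is_fcalcP[/bounded_opP[lB [kB hB]] hf] := fB.
have /is_fcalcP[/bounded_opP[lC [kC hC]] hg] := gC.
apply/is_fcalcP; split.
  apply/bounded_opP; split; first by move=> a u v; rewrite lB lC scalerDr addrACA.
  exists (kB + kC) => v; rewrite mulrDl (le_trans (rnormD _ _))//.
  by rewrite lerD ?hB ?hC.
move=> e e0; have e2 : 0 < e / 2 by rewrite divr_gt0.
have [p [pf pB]] := hf _ e2; have [q [qg qC]] := hg _ e2.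
exists (p + q); split=> [t At|v].
  rewrite hornerE opprD addrACA (le_trans (ler_normD _ _))// [leRHS]splitr.
  by rewrite lerD ?pf ?qg.
rewrite poly_opD opprD addrACA (le_trans (rnormD _ _))// [e in leRHS]splitr mulrDl.
by rewrite lerD.
Qed.

Lemma is_fcalc_const A (c : R) : bsym A -> is_fcalc (fun=> c) A (fun v => c%:C *: v).
Proof.
move=> bA; have := is_fcalc_poly c%:P bA.
rewrite (_ : poly_op _ _ = fun v => c%:C *: v).
  by apply: is_fcalc_ext => t _; rewrite hornerC.
by apply: funext => v; rewrite poly_opC.
Qed.

Lemma is_fcalc_id A : bsym A -> is_fcalc id A A.
Proof.
move=> bA; have := is_fcalc_poly 'X bA; rewrite (_ : poly_op _ _ = A).
  by apply: is_fcalc_ext => t _; rewrite hornerX.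
by apply: funext => v; rewrite poly_opX.
Qed.

Lemma is_fcalc_mul A f g B C : bsym A -> is_fcalc f A B -> is_fcalc g A C ->
  is_fcalc (fun t => f t * g t) A (B \o C).
Proof.
move=> bA fB gC.
have [F F0 hF] := is_fcalc_bounded bA fB; have [G G0 hG] := is_fcalc_bounded bA gC.
have /is_fcalcP[bB hf] := fB; have /is_fcalcP[bC hg] := gC.
have /bounded_opP[lB /bddP[kB kB0 hB]] := bB.
have /bounded_opP[lC /bddP[kC kC0 hC]] := bC.
apply/is_fcalcP; split; first exact: bounded_comp.
move=> e e0; pose K := F + G + kB + kC + 1.
have K1 : 1 <= K by rewrite /K lerDr !addr_ge0// ltW.
have K0 : 0 < K by exact: lt_le_trans ltr01 K1.
pose d := Num.min 1 (e / K).
have d0 : 0 < d by rewrite lt_min ltr01 divr_gt0.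
have d1 : d <= 1 by rewrite ge_min lexx.
have dK : d * K <= e by rewrite -ler_pdivlMr// ge_min lexx orbT.
have [p [pf pB]] := hf d d0; have [q [qg qC]] := hg d d0.
exists (p * q); split=> [t At|v].
  have -> : (p * q).[t] - f t * g t =
      (p.[t] - f t) * (q.[t] - g t) + f t * (q.[t] - g t) + (p.[t] - f t) * g t.
    by rewrite hornerM; ring.
  have h1 := pf t At; have h2 := qg t At; have h3 := hF t At; have h4 := hG t At.
  apply: le_trans (ler_normD _ _) _.
  apply: le_trans (lerD (ler_normD _ _) (lexx _)) _; rewrite !normrM.
  have h5 : `|p.[t] - f t| * `|q.[t] - g t| <= d * 1 by rewrite ler_pM// (le_trans h2).
  have h6 : `|f t| * `|q.[t] - g t| <= F * d by rewrite ler_pM.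
  have h7 : `|p.[t] - f t| * `|g t| <= d * G by rewrite ler_pM.
  by move: h5 h6 h7 dK; rewrite /K; nra.
rewrite (poly_opM _ _ _ (bsym_lin bA)) /=.
have -> : poly_op p A (poly_op q A v) - B (C v) =
   (poly_op p A (poly_op q A v - C v) - B (poly_op q A v - C v))
   + B (poly_op q A v - C v) + (poly_op p A (C v) - B (C v)).
  rewrite subrK (linB _ _ (bsym_lin (bsym_poly p bA))).
  by rewrite subrKA.
set w := poly_op q A v - C v.
have hw : rnorm w <= d * rnorm v by exact: qC.
have h1 : rnorm (poly_op p A w - B w) <= d * rnorm w by exact: pB.
have h2 := hB w.
have h3 : rnorm (poly_op p A (C v) - B (C v)) <= d * rnorm (C v) by exact: pB.
have h4 := hC v.
apply: le_trans (rnormD _ _) _.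
apply: le_trans (lerD (rnormD _ _) (lexx _)) _.
have n0 := rnorm_ge0 v; have w0 := rnorm_ge0 w.
have h5 : d * rnorm w <= 1 * (d * rnorm v) by rewrite ler_pM// ltW.
have h6 : kB * rnorm w <= kB * (d * rnorm v) by rewrite ler_wpM2l// ltW.
have h7 : d * rnorm (C v) <= d * (kC * rnorm v) by rewrite ler_wpM2l// ltW.
apply: le_trans (_ : d * K * rnorm v <= _); last by rewrite ler_wpM2r.
have h8 : 0 <= d * F * rnorm v by rewrite !mulr_ge0// ltW.
have h9 : 0 <= d * G * rnorm v by rewrite !mulr_ge0// ltW.
by rewrite /K !mulrDr !mulrDl; lra.
Qed.

Lemma is_fcalc_scale A (c : R) f B : bsym A -> is_fcalc f A B ->
  is_fcalc (fun t => c * f t) A (fun v => c%:C *: B v).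
Proof. by move=> bA fB; exact: is_fcalc_mul (is_fcalc_const c bA) fB. Qed.

Lemma is_fcalc_horner A f B q : bsym A -> is_fcalc f A B ->
  is_fcalc (fun t => q.[f t]) A (poly_op q B).
Proof.
move=> bA fB; elim/poly_ind: q => [|q c ih].
  have := is_fcalc_const 0 bA; rewrite (_ : poly_op _ _ = fun v => 0%:C *: v).
    by apply: is_fcalc_ext => t _; rewrite horner0.
  by apply: funext => v; rewrite -(poly_opC _ B) polyC0.
have := is_fcalc_add (is_fcalc_mul bA ih fB) (is_fcalc_const c bA) bA.
rewrite (_ : poly_op (q * 'X + c%:P) B = fun v => (poly_op q B \o B) v + c%:C *: v).
  by apply: is_fcalc_ext => t _; rewrite !hornerE.
by apply: funext => v; rewrite poly_opD poly_opMX poly_opC.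
Qed.

(** Polynomials [q] close to [g] reduce this to [is_fcalc_horner]; the
    approximation is required on the values of [f] as well as on the spectrum of
    [f(A)], which avoids comparing these two sets. *)
Lemma is_fcalc_comp A f g B C : bsym A ->
  is_fcalc f A B -> is_fcalc g B C ->
  poly_approx g (f @` rspec A `|` rspec B) ->
  is_fcalc (g \o f) A C.
Proof.
move=> bA fB gC ga; have bB := is_fcalc_bsym bA fB.
apply/is_fcalcP; split; first exact: gC.1.
move=> e e0; have e2 : 0 < e / 2 by rewrite divr_gt0.
have [q qg] := ga _ e2.
have /is_fcalcP[_ /(_ _ e2)[p [pq pB]]] := is_fcalc_horner q bA fB.
exists p; split=> [t At|v].
  rewrite -(subrKA q.[f t]) (le_trans (ler_normD _ _))// [leRHS]splitr.
  by rewrite lerD ?pq// /= qg//; left; exists t.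
rewrite -(subrKA (poly_op q B v)) (le_trans (rnormD _ _))// [e in leRHS]splitr.
rewrite mulrDl lerD//; apply: (is_fcalc_near bB gC (ltW e2)) => t Bt.
by apply: qg; right.
Qed.

Lemma is_fcalc_ge0 A f B : bsym A -> is_fcalc f A B ->
  (forall t, rspec A t -> 0 <= f t) -> forall v, 0 <= rdot (B v) v.
Proof.
move=> bA /is_fcalcP[bB fB] f0 v; rewrite -oppr_le0.
apply: (@le0_small_mul _ _ (2 * rdot v v)) => e e0.
have [p [pf pB]] := fB e e0.
have := @poly_op_ge0 _ _ (p + e%:P) A bA.1 bA.2 _ v.
rewrite poly_opD poly_opC rdotDl rdotZl => h.
have h1 : 0 <= rdot (poly_op p A v) v + e * rdot v v.
  apply: h => t At; rewrite !hornerE; have := f0 t At.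
  by have := pf t At; rewrite ler_norml => /andP[]; lra.
have := op_bound_form v pB; rewrite rdotBl ler_norml => /andP[_]; lra.
Qed.

Lemma is_fcalc_le A f g B C : bsym A -> is_fcalc f A B -> is_fcalc g A C ->
  (forall t, rspec A t -> f t <= g t) -> forall v, rdot (B v) v <= rdot (C v) v.
Proof.
move=> bA fB gC fg v.
have := is_fcalc_add gC (is_fcalc_scale (-1) bA fB) bA => /(is_fcalc_ge0 bA)/(_ _ v).
rewrite rdotDl rdotZl mulN1r subr_ge0; apply=> t At.
by rewrite mulN1r subr_ge0 fg.
Qed.

End CalculusRules.

(** * Weierstrass approximation *)

Section Weierstrass.
Variable R : realType.
Implicit Types (f h : R -> R) (x y a b : R).

(** The Bernstein polynomial of the values [h 0, ..., h n], that is the expectation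
    of [h] under the binomial law of parameters [n] and ['X], computed by
    conditioning on the first trial. *)
Fixpoint bernstein (n : nat) (h : nat -> R) : {poly R} :=
  if n is n'.+1 then
    (1 - 'X) * bernstein n' h + 'X * bernstein n' (fun k => h k.+1)
  else (h 0%N)%:P.

(** The binomial law has mean [n x] and variance [n x (1 - x)], so the right-hand
    side is the expectation of the bound on [|h k - y|]. *)
Lemma bernstein_near n (h : nat -> R) x y (c e D : R) : 0 <= x <= 1 ->
  (forall k, (k <= n)%N -> `|h k - y| <= e + D * (k%:R - c) ^+ 2) ->
  `|(bernstein n h).[x] - y| <=
    e + D * (n%:R * x * (1 - x) + (n%:R * x - c) ^+ 2).
Proof.
move=> /andP[x0 x1]; elim: n h c => [|n ih] h c hy /=.
  rewrite hornerC (le_trans (hy 0%N (leqnn 0)))//.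
  by rewrite mulr0n !mul0r !add0r.
rewrite !hornerE.
set u := (bernstein n h).[x]; set v := (bernstein n (fun k => h k.+1)).[x].
have -> : (1 - x) * u + x * v - y = (1 - x) * (u - y) + x * (v - y) by ring.
have hu : `|u - y| <= e + D * (n%:R * x * (1 - x) + (n%:R * x - c) ^+ 2).
  by apply: ih => k kn; apply: hy; exact: leqW.
have hv : `|v - y| <= e + D * (n%:R * x * (1 - x) + (n%:R * x - (c - 1)) ^+ 2).
  apply: ih => k kn; have := hy k.+1 kn.
  by rewrite -natr1 (_ : k%:R + 1 - c = k%:R - (c - 1))//; ring.
apply: le_trans (ler_normD _ _) _; rewrite !normrM.
rewrite (ger0_norm x0) (@ger0_norm _ (1 - x)) ?subr_ge0//.
have hu' := ler_wpM2l _ hu; have hv' := ler_wpM2l x0 hv.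
apply: le_trans (lerD (hu' (1 - x) _) hv') _; first by rewrite subr_ge0.
rewrite le_eqVlt; apply/orP; left; apply/eqP; rewrite -natr1; ring.
Qed.

(** Uniform continuity, in the quadratic form that the variance of the binomial
    law turns into uniform approximation. *)
Definition quad_modulus f a b := forall e : R, 0 < e -> exists C : R,
  forall x y, a <= x <= b -> a <= y <= b -> `|f x - f y| <= e + C * (x - y) ^+ 2.

Lemma poly_approx_itv f a b : a < b -> quad_modulus f a b ->
  poly_approx f [set t | a <= t <= b].
Proof.
move=> ab fm e e0.
have [|C hC] := fm (e / 2); first by rewrite divr_gt0.
have l0 : 0 < b - a by rewrite subr_gt0.
pose K := `|C| * (b - a) ^+ 2.
have K0 : 0 <= K by rewrite mulr_ge0// sqr_ge0.
have [n [n0 Kn]] : exists n : nat, 0 < n%:R :> R /\ K / n%:R <= e / 2.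
  exists (Num.bound (K / (e / 2))).+1; split; first by rewrite ltr0n.
  rewrite ler_pdivrMr ?ltr0n// mulrC -ler_pdivrMr ?divr_gt0//.
  apply: ltW; apply: lt_le_trans (archi_boundP _) _.
    by rewrite divr_ge0// ltW// divr_gt0.
  by rewrite ler_nat.
pose h k := f (a + (b - a) * (k%:R / n%:R)).
exists (bernstein n h \Po ((b - a)^-1 *: ('X - a%:P))) => t /andP[at_ tb].
rewrite horner_comp !hornerE; set x := _ * (t - a).
have x01 : 0 <= x <= 1.
  rewrite /x mulrC divr_ge0 ?subr_ge0//=; last exact: ltW.
  by rewrite ler_pdivrMr// mul1r lerD2r.
have tE : t = a + (b - a) * x by rewrite /x; field; rewrite gt_eqF.
clearbody x.
apply: le_trans (@bernstein_near n h x (f t) (n%:R * x) (e / 2)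
  (K / n%:R ^+ 2) x01 _) _ => [k kn|].
  have kn1 : 0 <= (k%:R / n%:R : R) <= 1.
    by rewrite divr_ge0 ?(ltW n0)//= ler_pdivrMr// mul1r ler_nat.
  apply: le_trans (@hC (a + (b - a) * (k%:R / n%:R)) t _ _) _.
  - case/andP: kn1 => k0 k1; rewrite lerDl mulr_ge0 ?(ltW l0)//=.
    by rewrite -lerBrDl ler_piMr// ltW.
  - by rewrite at_ tb.
  rewrite lerD2l {1}tE.
  have -> : a + (b - a) * (k%:R / n%:R) - (a + (b - a) * x) =
     (b - a) * (k%:R - n%:R * x) / n%:R by field; rewrite gt_eqF.
  rewrite [leRHS](_ : _ = `|C| * ((b - a) * (k%:R - n%:R * x) / n%:R) ^+ 2).
    by rewrite ler_wpM2r ?sqr_ge0// ler_norm.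
  by rewrite /K; field; rewrite gt_eqF.
rewrite subrr expr0n /= addr0 [leRHS]splitr lerD2l.
apply: le_trans Kn.
rewrite [leLHS](_ : _ = K / n%:R * (x * (1 - x))); last by field; rewrite gt_eqF.
rewrite ler_piMr ?divr_ge0 ?(ltW n0)//.
by case/andP: x01 => x0 x1; nra.
Qed.

(** [L d <= e + (L d)^2 / (4 e)]. *)
Lemma lipschitz_quad_modulus f a b (L : R) : 0 <= L ->
  (forall x y, a <= x -> x <= y -> y <= b -> `|f x - f y| <= L * (y - x)) ->
  quad_modulus f a b.
Proof.
move=> L0 fL e e0; exists (L ^+ 2 / (4 * e)) => x y.
have key d : L * d <= e + L ^+ 2 / (4 * e) * d ^+ 2.
  rewrite -subr_ge0 (_ : _ - _ = (2 * e - L * d) ^+ 2 / (4 * e)); last first.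
    by field; rewrite gt_eqF.
  by rewrite divr_ge0 ?sqr_ge0// mulr_ge0// ltW.
wlog xy : x y / x <= y.
  move=> hw xab yab; have [xy|/ltW yx] := leP x y; first exact: hw.
  by rewrite distrC -[(_ - _) ^+ 2]sqrrN opprB; exact: hw.
move=> /andP[ax _] /andP[_ yb]; apply: le_trans (fL x y ax xy yb) _.
by rewrite -[(_ - _) ^+ 2]sqrrN opprB; exact: key.
Qed.

(** If [s = |sqrt x - sqrt y|] exceeds [e] then [s <= s^4 / e^3], and
    [s^2 <= |x - y|]. *)
Lemma sqrt_quad_modulus b : quad_modulus Num.sqrt 0 b.
Proof.
move=> e e0; exists (e ^- 3) => x y.
wlog xy : x y / x <= y.
  move=> hw xab yab; have [xy|/ltW yx] := leP x y; first exact: hw.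
  by rewrite distrC -[(_ - _) ^+ 2]sqrrN opprB; exact: hw.
move=> /andP[x0 _] /andP[y0 _].
rewrite distrC ger0_norm ?subr_ge0 ?ler_wsqrtr//.
rewrite -{2}(sqr_sqrtr x0) -{2}(sqr_sqrtr y0).
have s0 : 0 <= Num.sqrt x by exact: sqrtr_ge0.
have st : Num.sqrt x <= Num.sqrt y by exact: ler_wsqrtr.
set s := Num.sqrt x in s0 st *; set t := Num.sqrt y in st *.
have [ts|ts] := leP (t - s) e.
  by apply: le_trans ts _; rewrite lerDl mulr_ge0 ?sqr_ge0// invr_ge0 exprn_ge0 ?ltW.
apply: le_trans (_ : (s ^+ 2 - t ^+ 2) ^+ 2 / e ^+ 3 <= _); last first.
  by rewrite mulrC lerDr ltW.
rewrite ler_pdivlMr ?exprn_gt0//.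
have d0 : 0 <= t - s by rewrite subr_ge0.
apply: le_trans (_ : (t - s) * (t - s) ^+ 3 <= _).
  by rewrite ler_wpM2l// lerXn2r ?nnegrE// ltW.
rewrite (_ : (s ^+ 2 - t ^+ 2) ^+ 2 = (t - s) ^+ 2 * (t + s) ^+ 2); last by ring.
rewrite -exprS (exprD _ 2 2) ler_wpM2l ?sqr_ge0// lerXn2r ?nnegrE//.
- by rewrite addr_ge0// (le_trans s0 st).
- by lra.
Qed.

(** [t `^ r = expR (r ln t)], where [ln] is Lipschitz away from [0] and [expR] is
    Lipschitz on bounded sets. *)
Lemma powR_quad_modulus (r a b : R) : 0 < a -> a <= b ->
  quad_modulus (fun t => t `^ r) a b.
Proof.
move=> a0 ab.
have expB (u v K : R) : u <= K -> v <= K -> `|expR u - expR v| <= expR K * `|u - v|.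
  wlog uv : u v / u <= v.
    move=> hw uK vK; have [uv|/ltW vu] := leP u v; first exact: hw.
    by rewrite distrC (distrC u); exact: hw.
  move=> _ vK; rewrite distrC (distrC u) ger0_norm ?subr_ge0 ?ler_expR//.
  rewrite ger0_norm ?subr_ge0//.
  apply: le_trans (_ : expR v * (v - u) <= _); last first.
    by rewrite ler_wpM2r ?subr_ge0// ler_expR.
  rewrite (_ : expR u = expR v * expR (u - v)); last by rewrite -expRD addrC subrK.
  rewrite -{1}[expR v]mulr1 -mulrBr ler_wpM2l ?expR_ge0//.
  by have := expR_ge1Dx (u - v); lra.
pose K := `|r| * (`|ln a| + `|ln b|).
apply: (@lipschitz_quad_modulus _ _ _ (expR K * (`|r| / a))).
  by rewrite mulr_ge0 ?expR_ge0// divr_ge0// ltW.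
move=> x y ax xy yb.
have x0 : 0 < x by exact: lt_le_trans ax.
have y0 : 0 < y by exact: lt_le_trans xy.
have b0 : 0 < b by exact: lt_le_trans yb.
have lnK z : a <= z -> z <= b -> r * ln z <= K.
  move=> az zb; rewrite (le_trans (ler_norm _))// normrM ler_wpM2l// ler_norml.
  have z0 : 0 < z by exact: lt_le_trans az.
  have h1 : ln a <= ln z by rewrite ler_ln.
  have h2 : ln z <= ln b by rewrite ler_ln.
  have := ler_norm (ln b); have := ler_norm (- ln a); rewrite normrN.
  by have := normr_ge0 (ln b); have := normr_ge0 (ln a); move=> *; apply/andP; split; lra.
rewrite /powR !gt_eqF//.
have h := expB _ _ K (lnK x ax (le_trans xy yb)) (lnK y (le_trans ax xy) yb).
apply: (le_trans h).
rewrite -mulrA ler_wpM2l ?expR_ge0// -mulrBr normrM -mulrA ler_wpM2l//.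
rewrite distrC ger0_norm ?subr_ge0 ?ler_ln//.
rewrite -ln_div// [leRHS]mulrC ler_pdivlMr//.
have {}h : ln (y / x) <= (y - x) / x.
  have -> : y / x = 1 + (y - x) / x by field; rewrite gt_eqF.
  apply: le_ln1Dx; apply: lt_le_trans (_ : 0 <= _); first by rewrite ltrN10.
  by rewrite divr_ge0 ?subr_ge0// ltW.
have h0 : 0 <= ln (y / x) by rewrite ln_ge0// ler_pdivlMr// mul1r.
move: h; rewrite ler_pdivlMr// => h.
by apply: le_trans h; rewrite ler_wpM2l.
Qed.

End Weierstrass.

(** * Positive invertible operators and their powers *)

Section PositiveOperators.
Variable R : realType.
Implicit Types (H : hilbertType R) (f g : R -> R).

Definition ole H (A B : H -> H) := forall v, rdot (A v) v <= rdot (B v) v.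

(** Invertible positive operators, with explicit bounds of the form; [m < M] keeps
    the interval containing the spectrum nondegenerate. *)
Definition posop H (A : H -> H) := bsym A /\ exists m M : R,
  [/\ 0 < m, m < M & forall v, m * rdot v v <= rdot (A v) v <= M * rdot v v].

(** Satisfied by the continuous functions on the positive half-line, this is what
    gives [f(A)] for every [posop A]. *)
Definition locally_approx f := forall a b : R, 0 < a -> a < b ->
  poly_approx f [set t | a <= t <= b].

Lemma posop_intro H (A : H -> H) (m : R) : bsym A -> 0 < m ->
  (forall v, m * rdot v v <= rdot (A v) v) -> posop A.
Proof.
move=> bA m0 mA; split=> //; have [k k0 kA] := bddP (bsym_bdd bA).
exists m, (m + k); split=> [//||v]; first by rewrite ltrDl.
rewrite mA /= mulrDl ler_wpDl ?mulr_ge0 ?rdot_ge0 ?(ltW m0)//.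
exact: le_trans (ler_norm _) (op_bound_form v kA).
Qed.

Lemma posdef_posop H (A : H -> H) : posdef A -> posop A.
Proof.
move=> [bA pA iA]; have /bounded_opP[lA _] := bA.
have [sA pA'] := (psdP lA).1 pA.
have [c c0 cA] := pos_invertible_below bA sA pA' iA.
exact: posop_intro cA.
Qed.

Lemma posop_rspec H (A : H -> H) : posop A -> exists m M : R,
  [/\ 0 < m, m < M & forall t, rspec A t -> m <= t <= M].
Proof.
move=> [bA [m [M [m0 mM mMA]]]]; exists m, M; split=> // t At.
apply/andP; split; [apply: (rspec_ge bA) At|apply: (rspec_le bA) At] => v;
  by have /andP[] := mMA v.
Qed.

Lemma posop_spectrum H (A : H -> H) : posop A ->
  spectrum A `<=` [set z | 0 < z].
Proof.
move=> pA z Az; have zE := sym_spectrum_real pA.1.1 pA.1.2 Az.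
have [m [M [m0 _ mA]]] := posop_rspec pA.
rewrite /= zE ltcR; have := mA (complex.Re z); rewrite /rspec /= -zE => /(_ Az).
by move=> /andP[/(lt_le_trans m0)].
Qed.

Lemma posop_fcalc H f (A : H -> H) : posop A -> locally_approx f ->
  is_fcalc f A (fcalc f A).
Proof.
move=> pA fa; apply: fcalcP; first exact: pA.1.
have [m [M [m0 mM mA]]] := posop_rspec pA.
by apply: poly_approx_sub (fa m M m0 mM) => t At; exact: mA.
Qed.

Lemma posop_comp H f g (A B : H -> H) (a b : R) : posop A -> posop B ->
  is_fcalc f A B -> 0 < a -> (forall t, rspec A t -> a <= f t <= b) ->
  locally_approx g -> is_fcalc (g \o f) A (fcalc g B).
Proof.
move=> pA pB fB a0 fab ga.
apply: is_fcalc_comp (fB) (posop_fcalc pB ga) _; first exact: pA.1.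
have [m [M [m0 mM mB]]] := posop_rspec pB.
have l0 : 0 < Num.min a m by rewrite lt_min a0.
have lu : Num.min a m < Num.max b M.
  by rewrite gt_min !lt_max mM !orbT.
apply: poly_approx_sub (ga _ _ l0 lu) => x [[t /fab/andP[h1 h2] <-]|/mB/andP[h1 h2]].
  by rewrite /= ge_min h1 le_max h2.
by rewrite /= ge_min h1 le_max h2 !orbT.
Qed.

Lemma powR_locally_approx (r : R) : locally_approx (fun t => t `^ r).
Proof.
move=> a b a0 ab; apply: poly_approx_itv => //.
by apply: powR_quad_modulus => //; exact: ltW.
Qed.

Lemma op_powRP H (A : H -> H) (r : R) : posop A ->
  is_fcalc (fun t => t `^ r) A (op_powR A r).
Proof. by move=> pA; apply: posop_fcalc => //; exact: powR_locally_approx. Qed.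

Lemma op_powRE H (A B : H -> H) (r : R) : posop A ->
  is_fcalc (fun t => t `^ r) A B -> op_powR A r = B.
Proof. by move=> pA rB; exact: fcalcE pA.1 rB. Qed.

Lemma rspec_gt0 H (A : H -> H) t : posop A -> rspec A t -> 0 < t.
Proof. by move=> /posop_rspec[m [M [m0 _ mA]]] /mA/andP[/(lt_le_trans m0)]. Qed.

Lemma op_powRD H (A : H -> H) (r s : R) v : posop A ->
  op_powR A (r + s) v = op_powR A r (op_powR A s v).
Proof.
move=> pA; rewrite (@op_powRE _ _ (op_powR A r \o op_powR A s))//.
apply: is_fcalc_ext (is_fcalc_mul pA.1 (op_powRP r pA) (op_powRP s pA)) => t At.
by rewrite powRD// (gt_eqF (rspec_gt0 pA At)) implybT.
Qed.

Lemma op_powR0 H (A : H -> H) v : posop A -> op_powR A 0 v = v.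
Proof.
move=> pA; rewrite (@op_powRE _ _ (fun v => 1%:C *: v)) ?scale1r//.
by apply: is_fcalc_ext (is_fcalc_const 1 pA.1) => t At; rewrite powRr0.
Qed.

Lemma op_powR1 H (A : H -> H) : posop A -> op_powR A 1 = A.
Proof.
move=> pA; apply: op_powRE => //.
apply: is_fcalc_ext (is_fcalc_id pA.1) => t At.
by rewrite powRr1// ltW// (rspec_gt0 pA At).
Qed.

Lemma op_powRK H (A : H -> H) (r : R) v : posop A ->
  op_powR A r (op_powR A (- r) v) = v.
Proof. by move=> pA; rewrite -op_powRD// subrr op_powR0. Qed.

Lemma op_powRNK H (A : H -> H) (r : R) v : posop A ->
  op_powR A (- r) (op_powR A r v) = v.
Proof. by move=> pA; rewrite -op_powRD// addNr op_powR0. Qed.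

Lemma op_powR_bsym H (A : H -> H) (r : R) : posop A -> bsym (op_powR A r).
Proof. by move=> pA; exact: is_fcalc_bsym pA.1 (op_powRP r pA). Qed.

(** [A^(- r)] is a bounded inverse of [A^r]. *)
Lemma op_powR_posop H (A : H -> H) (r : R) : posop A -> posop (op_powR A r).
Proof.
move=> pA; have bB := op_powR_bsym r pA; apply: posdef_posop; split.
- exact: bB.1.
- apply/psdP; first exact: bsym_lin.
  split; first exact: bB.2.
  by apply: is_fcalc_ge0 (op_powRP r pA) _; [exact: pA.1|move=> t _; exact: powR_ge0].
exists (op_powR A (- r)); split=> [|v|v]; first exact: (op_powR_bsym _ pA).1.
  by rewrite op_powRNK.
by rewrite op_powRK.
Qed.

Lemma powR_rspec_bounds H (A : H -> H) (r : R) : posop A -> exists a b : R,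
  0 < a /\ forall t, rspec A t -> a <= t `^ r <= b.
Proof.
move=> pA.
have [F F0 hF] := is_fcalc_bounded pA.1 (op_powRP r pA).
have [G G0 hG] := is_fcalc_bounded pA.1 (op_powRP (- r) pA).
exists G^-1, F; split=> [|t At]; first by rewrite invr_gt0.
have t0 := rspec_gt0 pA At.
rewrite (le_trans (ler_norm _) (hF t At)) andbT.
rewrite invf_ple ?posrE ?powR_gt0// -powRN.
exact: le_trans (ler_norm _) (hG t At).
Qed.

Lemma op_powRM H (A : H -> H) (r s : R) : posop A ->
  op_powR (op_powR A r) s = op_powR A (r * s).
Proof.
move=> pA; apply/esym/op_powRE => //.
have [a [b [a0 ab]]] := powR_rspec_bounds r pA.
have := posop_comp pA (op_powR_posop r pA) (op_powRP r pA) a0 ab (powR_locally_approx s).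
by apply: is_fcalc_ext => t _ /=; rewrite powRrM.
Qed.

Lemma posop_scale H (A : H -> H) (c : R) : 0 < c -> posop A ->
  posop (fun v => c%:C *: A v).
Proof.
move=> c0 pA; have [bA [m [M [m0 mM mMA]]]] := pA.
have cA := is_fcalc_scale c pA.1 (is_fcalc_id pA.1).
apply: (@posop_intro _ _ (c * m)); first exact: is_fcalc_bsym pA.1 cA.
  by rewrite mulr_gt0.
move=> v; rewrite rdotZl -mulrA ler_wpM2l ?(ltW c0)//.
by have /andP[] := mMA v.
Qed.

Lemma op_powR_scale H (A : H -> H) (c r : R) : 0 < c -> posop A ->
  op_powR (fun v => c%:C *: A v) r = fun v => (c `^ r)%:C *: op_powR A r v.
Proof.
move=> c0 pA.
have cA := is_fcalc_scale c pA.1 (is_fcalc_id pA.1).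
have [m [M [m0 mM mA]]] := posop_rspec pA.
have cmM t : rspec A t -> c * m <= c * t <= c * M.
  by move=> /mA/andP[h1 h2]; rewrite !ler_wpM2l ?(ltW c0).
have h := posop_comp pA (posop_scale c0 pA) cA (mulr_gt0 c0 m0) cmM
  (powR_locally_approx r).
apply: is_fcalc_unique pA.1 h _.
apply: is_fcalc_ext (is_fcalc_scale (c `^ r) pA.1 (op_powRP r pA)) => t At.
by rewrite /= powRM// ltW// (rspec_gt0 pA At).
Qed.

End PositiveOperators.

(** * The Loewner-Heinz inequality *)

Section LoewnerHeinz.
Variables (R : realType) (H : hilbertType R).
Implicit Types (A B N S D : H -> H) (u v : H).

(** If the supremum [l] of the form of [S] were above [1], then
    [l - S = D (l - N) D'] would be invertible by the Neumann series, whereas [l]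
    is in the spectrum of [S]. *)
Lemma similar_contraction_form_le S N D D' : bsym S -> linear N ->
  op_bound 1 N -> bounded_op D -> bounded_op D' -> cancel D D' -> cancel D' D ->
  (forall v, S v = D (N (D' v))) -> forall v, rdot (S v) v <= rdot v v.
Proof.
move=> bS lN N1 bD bD' DK KD SE v.
have [->|vn] := eqVneq v 0; first by rewrite !rdot0r.
have vex : exists v : H, v != 0 by exists v.
have lS := bsym_lin bS; have [k kS] := bsym_bdd bS.
have bT : bounded_op (fun v => - S v).
  apply/bounded_opP; split; first by move=> a u w; rewrite lS opprD scalerN.
  by exists k => w; rewrite rnormN; exact: kS.
have sT : sym (fun v => - S v) by move=> u w; rewrite rdotNl rdotNr bS.2.
have [m [Tm mT]] := inf_form_spectrum bT sT vex.
have m1 : -1 <= m; last first.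
  have := mT v; rewrite rdotNl => h.
  by have := rdot_ge0 v; nra.
rewrite leNgt; apply/negP => m1; apply: Tm.
have m0 : m < 0 by lra.
have lD : linear D by have /bounded_opP[] := bD.
have lN' : linear (fun v => (- m)^-1%:C *: N v).
  by move=> a u w; rewrite lN scalerDr !scalerA mulrC.
have iN : invertible_op (fun v => (- m)%:C *: (v - (- m)^-1%:C *: N v)).
  apply: invertible_scale; last 2 first.
  - by rewrite oppr_eq0 lt_eqF.
  - apply: (@neumann _ _ _ (- m)^-1) => //.
      by rewrite invf_lt1; lra.
    move=> w; rewrite rnormZ ger0_norm; last by rewrite invr_ge0; lra.
    rewrite ler_wpM2l//; first by rewrite invr_ge0; lra.
    by have := N1 w; rewrite mul1r.
  by move=> a u w; rewrite lN' scalerBr opprD addrACA.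
have iD : invertible_op D by exists D'.
have iD' : invertible_op D' by exists D.
have := invertible_comp iD (invertible_comp iN iD').
congr invertible_op; apply: funext => w /=.
rewrite scalerBr scalerA -rcM mulfV ?oppr_eq0 ?lt_eqF// scale1r.
by rewrite (linB _ _ lD) (linZ _ _ lD) KD -SE rcN scaleNr addrC.
Qed.

Lemma contraction_adjoint S N : (forall u v, rdot (S u) v = rdot u (N v)) ->
  op_bound 1 S -> op_bound 1 N.
Proof.
move=> SN S1 v; rewrite mul1r; have [->|n0] := eqVneq (rnorm (N v)) 0.
  exact: rnorm_ge0.
have np : 0 < rnorm (N v) by rewrite lt_neqAle eq_sym n0 rnorm_ge0.
rewrite -(ler_pM2l np) -expr2 -rdotvv -SN (le_trans (rdot_norm _ _))//.
by rewrite ler_wpM2r ?rnorm_ge0//; have := S1 (N v); rewrite mul1r.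
Qed.

Section Monotone.
Variables A B : H -> H.
Hypotheses (pA : posop A) (pB : posop B) (AB : ole A B).

Let E (r : R) := ole (op_powR A r) (op_powR B r).

(** [|A^(r/2) w|^2] is the form of [A^r] at [w], and [|v|^2] that of [B^r] at
    [w = B^(- r/2) v]. *)
Lemma half_contraction (r : R) : E r ->
  op_bound 1 (fun v => op_powR A (r / 2) (op_powR B (- (r / 2)) v)).
Proof.
move=> Er v; rewrite mul1r -ler_sqr ?nnegrE ?rnorm_ge0// -!rdotvv.
set w := op_powR B _ v.
rewrite (op_powR_bsym _ pA).2 -op_powRD// -splitr rdotC (le_trans (Er w))//.
rewrite {1}(splitr r) op_powRD// (op_powR_bsym _ pB).2 /w op_powRK//.
Qed.

(** For [c] the midpoint of [a] and [b], the symmetric operator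
    [B^(-c/2) A^c B^(-c/2)] is similar to
    [(B^(-a/2) A^(a/2)) (A^(b/2) B^(-b/2))], a product of contractions. *)
Lemma op_powR_mono_midpoint (a b : R) : E a -> E b -> E ((a + b) / 2).
Proof.
move=> Ea Eb; set c := (a + b) / 2.
have symA r := (op_powR_bsym r pA).2; have symB r := (op_powR_bsym r pB).2.
pose S v := op_powR B (- (c / 2)) (op_powR A c (op_powR B (- (c / 2)) v)).
pose N v := op_powR B (- (a / 2)) (op_powR A c (op_powR B (- (b / 2)) v)).
have bS : bsym S.
  split; last by move=> u v; rewrite /S symB symA symB.
  exact: bounded_comp (op_powR_bsym _ pB).1
    (bounded_comp (op_powR_bsym _ pA).1 (op_powR_bsym _ pB).1).
have lN : linear N.
  by move=> z u v; rewrite /N !(bsym_lin (op_powR_bsym _ pB), bsym_lin (op_powR_bsym _ pA)).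
have N1 : op_bound 1 N.
  have NE v : N v = op_powR B (- (a / 2)) (op_powR A (a / 2)
      (op_powR A (b / 2) (op_powR B (- (b / 2)) v))).
    rewrite /N (_ : c = a / 2 + b / 2) ?(op_powRD (a / 2))//.
    by rewrite /c mulrDl.
  have h1 := half_contraction Eb.
  have h2 : op_bound 1 (fun v => op_powR B (- (a / 2)) (op_powR A (a / 2) v)).
    apply: contraction_adjoint (half_contraction Ea) => u v.
    by rewrite symA symB.
  by move=> v; rewrite NE (le_trans (h2 _))// mul1r.
have SN := @similar_contraction_form_le S N (op_powR B ((a - b) / 4))
  (op_powR B (- ((a - b) / 4))) bS lN N1 (op_powR_bsym _ pB).1 (op_powR_bsym _ pB).1
  (fun v => op_powRNK _ v pB) (fun v => op_powRK _ v pB) _.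
have S1 v : rdot (S v) v <= rdot v v.
  apply: SN => {}v; rewrite /S /N -!op_powRD//; congr (op_powR B _ (op_powR A _ _)).
    by rewrite /c; field.
  by congr (op_powR B _ _); rewrite /c; field.
move=> v; have := S1 (op_powR B (c / 2) v); rewrite /S op_powRNK// symB op_powRNK//.
by rewrite symB -op_powRD// -splitr (rdotC v).
Qed.

Lemma op_powR_mono_bisect (r : R) (n : nat) : 0 <= r <= 1 ->
  exists a b : R, [/\ E a, E b, a <= r <= b & b - a <= 2^-1 ^+ n].
Proof.
move=> r01; elim: n => [|n [a [b [Ea Eb /andP[ar rb] ab]]]].
  exists 0, 1; split=> //.
  - by move=> v; rewrite !op_powR0.
  - by rewrite /E !op_powR1.
  - by rewrite subr0 expr0.
have Ec := op_powR_mono_midpoint Ea Eb.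
have hs : (b - a) / 2 <= 2^-1 ^+ n.+1 by rewrite exprSr ler_pM2r ?invr_gt0.
have [rc|cr] := leP r ((a + b) / 2).
  by exists a, ((a + b) / 2); split=> //; [rewrite ar rc|lra].
by exists ((a + b) / 2), b; split=> //; [rewrite rb ltW|lra].
Qed.

(** [t `^ r = t `^ s * expR ((r - s) ln t)]. *)
Lemma op_powR_exponent_near (C : H -> H) (K d r s : R) : posop C -> 0 <= K ->
  (forall t, rspec C t -> `|ln t| <= K) -> `|r - s| <= d ->
  forall v, rdot (op_powR C r v) v <= expR (d * K) * rdot (op_powR C s v) v.
Proof.
move=> pC K0 hK rs v; rewrite -rdotZl.
apply: (is_fcalc_le pC.1 (op_powRP r pC) (is_fcalc_scale _ pC.1 (op_powRP s pC))) => t Ct.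
have t0 := rspec_gt0 pC Ct.
rewrite /powR gt_eqF// -expRD ler_expR -lerBlDr -mulrBl.
rewrite (le_trans (ler_norm _))// normrM ler_pM ?hK//.
Qed.

Lemma ln_rspec_bounded (C : H -> H) : posop C ->
  exists2 K : R, 0 <= K & forall t, rspec C t -> `|ln t| <= K.
Proof.
move=> pC; have [m [M [m0 mM mC]]] := posop_rspec pC.
exists (`|ln m| + `|ln M|) => [|t /mC/andP[mt tM]]; first by rewrite addr_ge0.
have t0 : 0 < t by exact: lt_le_trans mt.
have h1 : ln m <= ln t by rewrite ler_ln.
have h2 : ln t <= ln M by rewrite ler_ln// posrE (lt_trans m0).
have := ler_norm (ln M); have := ler_norm (- ln m); rewrite normrN ler_norml.
by have := normr_ge0 (ln M); have := normr_ge0 (ln m); move=> *; apply/andP; split; lra.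
Qed.

(** Exponents that preserve the order are found within any [e] of [r] by bisection
    from [0] and [1]; changing the exponent by [e] costs a factor close to [1]. *)
Theorem loewner_heinz (r : R) : 0 <= r <= 1 -> ole (op_powR A r) (op_powR B r).
Proof.
move=> r01 v.
have [KA KA0 hA] := ln_rspec_bounded pA; have [KB KB0 hB] := ln_rspec_bounded pB.
set x := rdot (op_powR A r v) v; set y := rdot (op_powR B r v) v.
have x0 : 0 <= x.
  by apply: is_fcalc_ge0 (op_powRP r pA) _ _; [exact: pA.1|move=> t _; exact: powR_ge0].
rewrite -subr_le0; apply: (@le0_small_mul _ _ ((KA + KB) * x)) => e e0.
have [||n /(_ n (leqnn n)) hn] := @geometric_small R 2^-1 e.
- by rewrite invr_ge0 ler0n invf_lt1 ?ltr1n.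
- exact: e0.
have [a [b [Ea _ /andP[ar rb] ab]]] := op_powR_mono_bisect n r01.
have rae : `|r - a| <= e by rewrite ger0_norm; lra.
have are : `|a - r| <= e by rewrite distrC.
have h1 := op_powR_exponent_near pA KA0 hA rae v.
have h2 := op_powR_exponent_near pB KB0 hB are v.
have h3 := Ea v.
have xy : x <= expR (e * (KA + KB)) * y.
  apply: le_trans h1 _; rewrite mulrDr expRD -mulrA ler_wpM2l ?expR_ge0//.
  exact: le_trans h3 h2.
have xy' : expR (- (e * (KA + KB))) * x <= y.
  have := ler_wpM2l (expR_ge0 (- (e * (KA + KB)))) xy.
  by rewrite mulrA -expRD addNr expR0 mul1r.
have := ler_wpM2r x0 (expR_ge1Dx (- (e * (KA + KB)))).
by rewrite mulrDl mul1r mulNr -mulrA; lra.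
Qed.

End Monotone.
End LoewnerHeinz.

(** * The operator Jensen inequality *)

Section LinearBounded.
Variable R : realType.
Implicit Types H : hilbertType R.

Definition lbd H H' (T : H -> H') := linear T /\ bdd T.

Lemma lbd_comp H H' H'' (S : H' -> H'') (T : H -> H') :
  lbd S -> lbd T -> lbd (fun v => S (T v)).
Proof.
move=> [lS /bddP[k k0 kS]] [lT [l lTb]]; split.
  by move=> a u v; rewrite lT lS.
by exists (k * l) => v; rewrite (le_trans (kS _))// -mulrA ler_wpM2l ?lTb ?(ltW k0).
Qed.

Lemma lbd_add H H' (S T : H -> H') : lbd S -> lbd T -> lbd (fun v => S v + T v).
Proof.
move=> [lS [k kS]] [lT [l lTb]]; split.
  by move=> a u v; rewrite lT lS scalerDr addrACA.
by exists (k + l) => v; rewrite (le_trans (rnormD _ _))// mulrDl lerD ?kS ?lTb.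
Qed.

Lemma lbd_scale H H' (c : R) (T : H -> H') : lbd T -> lbd (fun v => c%:C *: T v).
Proof.
move=> [lT [l lTb]]; split.
  by move=> a u v; rewrite lT scalerDr !scalerA mulrC.
by exists (`|c| * l) => v; rewrite rnormZ -mulrA ler_wpM2l ?lTb.
Qed.

Lemma lbd_opp H H' (T : H -> H') : lbd T -> lbd (fun v => - T v).
Proof.
move=> [lT [l lTb]]; split; first by move=> a u v; rewrite lT opprD scalerN.
by exists l => v; rewrite rnormN lTb.
Qed.

Lemma lbd_id H : lbd (fun v : H => v).
Proof. by split=> //; exists 1 => v; rewrite mul1r. Qed.

Lemma lbd_bounded H (T : H -> H) : lbd T -> bounded_op T.
Proof. by move=> ?; apply/bounded_opP. Qed.

Lemma bsym_lbd H (T : H -> H) : bsym T -> lbd T.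
Proof. by move=> [/bounded_opP]. Qed.

End LinearBounded.

Section SumOperators.
Variables (R : realType) (H : hilbertType R).
Notation T := (hsumH H).

Definition inj1 (x : H) : T := (x, 0).
Definition inj2 (x : H) : T := (0, x).
Definition prj1 (z : T) : H := z.1.
Definition prj2 (z : T) : H := z.2.

Lemma rdot_sum (z w : T) :
  rdot z w = rdot (prj1 z) (prj1 w) + rdot (prj2 z) (prj2 w).
Proof. by rewrite {1}/rdot /= /sdot raddfD. Qed.

Lemma sum_decomp (z : T) : z = inj1 (prj1 z) + inj2 (prj2 z).
Proof.
by case: z => x y; congr pair; rewrite /= ?addr0 ?add0r.
Qed.

Lemma prj1D (z w : T) : prj1 (z + w) = prj1 z + prj1 w. Proof. by []. Qed.
Lemma prj2D (z w : T) : prj2 (z + w) = prj2 z + prj2 w. Proof. by []. Qed.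

Lemma inj1_lbd : lbd inj1.
Proof.
split.
  move=> a u v; change (inj1 (a *: u + v) = (a *: u + v, a *: 0 + 0)).
  by rewrite scaler0 addr0.
exists 1 => v; rewrite mul1r -ler_sqr ?nnegrE ?rnorm_ge0// -!rdotvv rdot_sum.
by rewrite /= rdot0l addr0.
Qed.

Lemma inj2_lbd : lbd inj2.
Proof.
split.
  move=> a u v; change (inj2 (a *: u + v) = (a *: 0 + 0, a *: u + v)).
  by rewrite scaler0 addr0.
exists 1 => v; rewrite mul1r -ler_sqr ?nnegrE ?rnorm_ge0// -!rdotvv rdot_sum.
by rewrite /= rdot0l add0r.
Qed.

Lemma prj1_lbd : lbd prj1.
Proof.
split=> //; exists 1 => v.
rewrite mul1r -ler_sqr ?nnegrE ?rnorm_ge0// -!rdotvv rdot_sum.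
by rewrite lerDl rdot_ge0.
Qed.

Lemma prj2_lbd : lbd prj2.
Proof.
split=> //; exists 1 => v.
rewrite mul1r -ler_sqr ?nnegrE ?rnorm_ge0// -!rdotvv rdot_sum.
by rewrite lerDr rdot_ge0.
Qed.

End SumOperators.

Section Jensen.
Variables (R : realType) (H : hilbertType R).

(** Operator monotonicity in terms of quadratic forms, with the values of the
    functional calculus given by specification. *)
Definition omono (g : R -> R) := forall (H : hilbertType R) (A B A' B' : H -> H),
  posop A -> posop B -> ole B A ->
  is_fcalc g A A' -> is_fcalc g B B' -> ole B' A'.

Lemma bsym_scalar (c : R) : bsym (fun v : H => c%:C *: v).
Proof.
split; first exact/lbd_bounded/lbd_scale/lbd_id.
by move=> u v; rewrite rdotZl rdotZr.
Qed.

Lemma posop_scalar (c : R) : 0 < c -> posop (fun v : H => c%:C *: v).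
Proof.
by move=> c0; apply: (posop_intro (bsym_scalar c) c0) => v; rewrite rdotZl.
Qed.

Lemma rspec_scalar (c t : R) : rspec (fun v : H => c%:C *: v) t -> t = c.
Proof.
move=> ct; apply/eqP; rewrite eq_le (rspec_le (bsym_scalar c) _ ct).
  by rewrite (rspec_ge (bsym_scalar c) _ ct)// => v; rewrite rdotZl.
by move=> v; rewrite rdotZl.
Qed.

Lemma is_fcalc_scalar (g : R -> R) (d : R) :
  is_fcalc g (fun v : H => d%:C *: v) (fun v => (g d)%:C *: v).
Proof.
apply: is_fcalc_ext (is_fcalc_const (g d) (bsym_scalar d)) => t dt.
by rewrite (rspec_scalar dt).
Qed.

Variables (g : R -> R) (gm : omono g).
Variables (B B' C C' : H -> H) (K K' L L' : H -> H) (d a eta : R) (S : set R).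
Hypotheses (pB : posop B) (pC : posop C) (fB : is_fcalc g B B')
  (fC : is_fcalc g C C').
Hypotheses (lK : lbd K) (lK' : lbd K') (lL : lbd L) (lL' : lbd L').
Hypotheses (KK : forall u v, rdot (K u) v = rdot u (K' v))
  (LL : forall u v, rdot (L u) v = rdot u (L' v))
  (KL : forall v, K (K' v) + L (L' v) = v).
Hypotheses (d0 : 0 < d) (eta0 : 0 < eta) (da : d <= a)
  (Ba : forall v, rdot (B v) v <= a * rdot v v).
Let N := (1 + eta^-1) * a.
Hypotheses (SB : rspec B `<=` S) (SC : rspec C `<=` S) (Sd : S d) (SN : S N)
  (gS : poly_approx g S).
Hypothesis BC : forall v,
  (1 + eta) * (rdot (B (K' v)) (K' v) + d * rdot (L' v) (L' v)) <= rdot (C v) v.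

Notation T := (hsumH H).

(* [V] is an isometry with adjoint [V'], and [V' At V = K B K' + d L L']. The
   operator [Ct] is [C] on the range of [V] and the large constant [N] on its
   orthogonal complement. *)
Let V (v : H) : T := inj1 (K' v) + inj2 (L' v).
Let V' (z : T) : H := K (prj1 z) + L (prj2 z).
Let At (z : T) : T := inj1 (B (prj1 z)) + inj2 (d%:C *: prj2 z).
Let Ct (z : T) : T := V (C (V' z)) + N%:C *: (z - V (V' z)).

Let lV : lbd V.
Proof. by apply: lbd_add; apply: lbd_comp => //; [exact: inj1_lbd|exact: inj2_lbd]. Qed.

Let lV' : lbd V'.
Proof. by apply: lbd_add; apply: lbd_comp => //; [exact: prj1_lbd|exact: prj2_lbd]. Qed.

Let prj1V v : prj1 (V v) = K' v. Proof. by rewrite prj1D /= addr0. Qed.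
Let prj2V v : prj2 (V v) = L' v. Proof. by rewrite prj2D /= add0r. Qed.

Let VV' v z : rdot (V v) z = rdot v (V' z).
Proof.
rewrite rdot_sum prj1V prj2V /V' rdotDr.
by rewrite (rdotC _ (K _)) KK rdotC (rdotC _ (L _)) LL (rdotC (L' v)).
Qed.

Let Vr v z : rdot z (V v) = rdot (V' z) v.
Proof. by rewrite rdotC VV' rdotC. Qed.

Let V'V v : V' (V v) = v.
Proof. by rewrite /V' prj1V prj2V KL. Qed.

Let prj1A z : prj1 (At z) = B (prj1 z). Proof. by rewrite prj1D /= addr0. Qed.
Let prj2A z : prj2 (At z) = d%:C *: prj2 z. Proof. by rewrite prj2D /= add0r. Qed.

Let bAt : bsym At.
Proof.
split.
  apply: lbd_bounded; apply: lbd_add.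
    apply: (lbd_comp (inj1_lbd H)); apply: lbd_comp (prj1_lbd H).
    exact: bsym_lbd pB.1.
  by apply: (lbd_comp (inj2_lbd H)); exact/lbd_scale/prj2_lbd.
move=> u v; rewrite !rdot_sum !prj1A !prj2A rdotZl rdotZr.
by rewrite pB.1.2.
Qed.

Let lproj : lbd (fun z : T => z - V (V' z)).
Proof.
by apply: lbd_add; [exact: lbd_id|apply: lbd_opp; exact: lbd_comp].
Qed.

Let bCt : bsym Ct.
Proof.
split.
  apply: lbd_bounded; apply: lbd_add; last exact: lbd_scale.
  apply: lbd_comp => //; apply: (lbd_comp (bsym_lbd pC.1)) => //.
move=> u v; rewrite /Ct [LHS]rdotDl [RHS]rdotDr rdotZl rdotZr rdotBl rdotBr.
by rewrite !VV' !Vr pC.1.2.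
Qed.

Let a0 : 0 < a. Proof. exact: lt_le_trans da. Qed.

Let N0 : 0 < N.
Proof. by rewrite mulr_gt0// ltr_pwDl// invr_ge0 ltW. Qed.

Let Vort z : rdot z z = rdot (V' z) (V' z) + rdot (z - V (V' z)) (z - V (V' z)).
Proof.
by rewrite !rdotBl !rdotBr !VV' !Vr V'V; ring.
Qed.

Let formC z : rdot (Ct z) z =
  rdot (C (V' z)) (V' z) + N * rdot (z - V (V' z)) (z - V (V' z)).
Proof.
rewrite /Ct rdotDl rdotZl VV'; congr (_ + _ * _).
by rewrite !rdotBl !rdotBr !VV' !Vr V'V; ring.
Qed.

Let formA z : rdot (At z) z =
  rdot (B (prj1 z)) (prj1 z) + d * rdot (prj2 z) (prj2 z).
Proof. by rewrite rdot_sum prj1A prj2A rdotZl. Qed.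

Let pAt : posop At.
Proof.
have [_ [m [M [m0 _ mB]]]] := pB.
apply: (@posop_intro _ _ _ (Num.min m d)) => //; first by rewrite lt_min m0.
move=> z; rewrite formA rdot_sum mulrDr lerD//.
  apply: le_trans (_ : m * rdot (prj1 z) (prj1 z) <= _).
    by rewrite ler_wpM2r ?rdot_ge0// ge_min lexx.
  by have /andP[] := mB (prj1 z).
by rewrite ler_wpM2r ?rdot_ge0// ge_min lexx orbT.
Qed.

Let pCt : posop Ct.
Proof.
have [_ [m [M [m0 _ mC]]]] := pC.
apply: (@posop_intro _ _ _ (Num.min m N)) => //; first by rewrite lt_min m0.
move=> z; rewrite formC Vort mulrDr lerD//.
  apply: le_trans (_ : m * rdot (V' z) (V' z) <= _).
    by rewrite ler_wpM2r ?rdot_ge0// ge_min lexx.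
  by have /andP[] := mC (V' z).
by rewrite ler_wpM2r ?rdot_ge0// ge_min lexx orbT.
Qed.

(** Write [z = V y + w] with [w] orthogonal to the range of [V]. Positivity of the
    form of [At] at [eta V y - w] bounds the cross term
    [2 rdot (At (V y)) w] by [eta rdot (At (V y)) (V y) + rdot (At w) w / eta]. *)
Let leAC : ole At Ct.
Proof.
move=> z; rewrite formC; set y := V' z; set w := z - V y.
have zE : z = V y + w by rewrite addrC subrK.
clearbody w; clearbody y; rewrite {z}zE.
have lA := bsym_lin bAt.
have pos : 0 <= rdot (At (eta%:C *: V y - w)) (eta%:C *: V y - w).
  have [_ [m [M [m0 _ mA]]]] := pAt.
  have /andP[h _] := mA (eta%:C *: V y - w).
  by apply: le_trans h; rewrite mulr_ge0 ?rdot_ge0 ?ltW.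
rewrite (linB _ _ lA) (linZ _ _ lA) !(rdotBl, rdotBr) !(rdotZl, rdotZr) in pos.
rewrite (bAt.2 w) (rdotC w) in pos.
have Aw : rdot (At w) w <= a * rdot w w.
  by rewrite formA rdot_sum mulrDr lerD// ler_wpM2r// rdot_ge0.
have AV : (1 + eta) * rdot (At (V y)) (V y) <= rdot (C y) y.
  by rewrite formA prj1V prj2V.
rewrite (linD _ _ lA) rdotDl [rdot (At (V y)) _]rdotDr [rdot (At w) _]rdotDr.
rewrite (bAt.2 w (V y)) (rdotC w (At _)).
have key : 2 * rdot (At (V y)) w <=
    eta * rdot (At (V y)) (V y) + eta^-1 * rdot (At w) w.
  rewrite -(ler_pM2l eta0) mulrDr [eta * (eta^-1 * _)]mulrA mulfV ?gt_eqF// mul1r.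
  by move: pos; lra.
have : (1 + eta^-1) * rdot (At w) w <= N * rdot w w.
  by rewrite /N -mulrA ler_wpM2l// addr_ge0// invr_ge0 ltW.
by move: key AV; lra.
Qed.

(** [At - t] is inverted blockwise; likewise [Ct - t] below, on the range of [V]
    and on its orthogonal complement. *)
Let specA : rspec At `<=` S.
Proof.
move=> t At_t; apply: contrapT => St; apply: At_t.
have td : d - t != 0 by apply/eqP => /subr0_eq tE; apply: St; rewrite -tE.
have [P [bP PK KP]] : invertible_op (fun v => B v - t%:C *: v).
  by apply: contrapT => Bt; exact: St (SB Bt).
exists (fun z : T => inj1 (P (prj1 z)) + inj2 ((d - t)^-1%:C *: prj2 z)); split.
- apply: lbd_bounded; apply: lbd_add.
    apply: (lbd_comp (inj1_lbd H)); apply: lbd_comp (prj1_lbd H).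
    exact/bounded_opP.
  by apply: (lbd_comp (inj2_lbd H)); exact/lbd_scale/prj2_lbd.
- move=> z; rewrite [RHS]sum_decomp; congr (inj1 _ + inj2 _).
    rewrite -[RHS]PK; congr P.
    by rewrite -prj1A.
  have -> : prj2 (At z - t%:C *: z) = prj2 (At z) - t%:C *: prj2 z by [].
  by rewrite prj2A -scalerBl -rcB scalerA -rcM mulVf// scale1r.
move=> z; set w : T := inj1 (P (prj1 z)) + inj2 ((d - t)^-1%:C *: prj2 z).
have w1 : prj1 w = P (prj1 z) by rewrite prj1D /= addr0.
have w2 : prj2 w = (d - t)^-1%:C *: prj2 z by rewrite prj2D /= add0r.
rewrite [LHS]sum_decomp [RHS]sum_decomp; congr (inj1 _ + inj2 _).
  have -> : prj1 (At w - t%:C *: w) = prj1 (At w) - t%:C *: prj1 w by [].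
  by rewrite prj1A w1 KP.
have -> : prj2 (At w - t%:C *: w) = prj2 (At w) - t%:C *: prj2 w by [].
by rewrite prj2A w2 -scalerBl -rcB scalerA -rcM mulfV// scale1r.
Qed.

Let specC : rspec Ct `<=` S.
Proof.
move=> t Ct_t; apply: contrapT => St; apply: Ct_t.
have tN : N - t != 0 by apply/eqP => /subr0_eq tE; apply: St; rewrite -tE.
have [P [bP PK KP]] : invertible_op (fun v => C v - t%:C *: v).
  by apply: contrapT => Bt; exact: St (SC Bt).
have [lV1 _] := lV; have [lV1' _] := lV'.
have /bounded_opP[lP bdP] := bP.
have CtE z : Ct z - t%:C *: z =
    V (C (V' z) - t%:C *: V' z) + (N - t)%:C *: (z - V (V' z)).
  rewrite /Ct rcB scalerBl (linB _ _ lV1) (linZ _ _ lV1).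
  have -> : t%:C *: z = t%:C *: V (V' z) + t%:C *: (z - V (V' z)).
    by rewrite -scalerDr addrC subrK.
  have ac (x y u w : T) : x + y - (u + w) = x - u + (y - w).
    by rewrite opprD addrACA.
  exact: ac.
have V'E x c z : V' (V x + c%:C *: (z - V (V' z))) = x.
  by rewrite (linD _ _ lV1') (linZ _ _ lV1') (linB _ _ lV1') !V'V subrr scaler0 addr0.
have pE x c z : V x + c%:C *: (z - V (V' z)) - V x = c%:C *: (z - V (V' z)).
  by rewrite addrAC subrr add0r.
exists (fun z : T => V (P (V' z)) + (N - t)^-1%:C *: (z - V (V' z))); split.
- apply: lbd_bounded; apply: lbd_add; last exact: lbd_scale.
  by apply: lbd_comp => //; apply: lbd_comp => //; split.
- move=> z; rewrite CtE V'E PK pE scalerA -rcM mulVf// scale1r.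
  by rewrite addrC subrK.
move=> z; rewrite CtE V'E KP pE scalerA -rcM mulfV// scale1r.
by rewrite addrC subrK.
Qed.

(** The operator Jensen inequality [K g(B) K' + g(d) L L' <= g(C)] for
    [C = (1 + eta) (K B K' + d L L')]. Since [V] intertwines [C] with [Ct], and [At]
    is the diagonal operator of [B] and [d], it is the inequality
    [g(At) <= g(Ct)] compressed to the range of [V]. *)
Lemma omono_jensen v :
  rdot (B' (K' v)) (K' v) + g d * rdot (L' v) (L' v) <= rdot (C' v) v.
Proof.
have fA1 : is_fcalc g At (fcalc g At).
  by apply: fcalcP; [exact: bAt|exact: poly_approx_sub gS].
have fC1 : is_fcalc g Ct (fcalc g Ct).
  by apply: fcalcP; [exact: bCt|exact: poly_approx_sub gS].
have A1 x : fcalc g At (inj1 x) = inj1 (B' x).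
  have [li bi] := inj1_lbd H.
  apply/esym; apply: (is_fcalc_intertwine pB.1 bAt li bi _ _ fB fA1).
    move=> u; rewrite [RHS]sum_decomp prj1A prj2A /= scaler0 [LHS]sum_decomp.
    by [].
  by apply: poly_approx_sub gS => t [/SB|/specA].
have A2 x : fcalc g At (inj2 x) = inj2 ((g d)%:C *: x).
  have [li bi] := inj2_lbd H.
  apply/esym; apply: (is_fcalc_intertwine (bsym_scalar d) bAt li bi _ _
    (is_fcalc_scalar g d) fA1).
    move=> u; rewrite [RHS]sum_decomp prj1A prj2A /= (lin0 (bsym_lin pB.1)).
    by rewrite [LHS]sum_decomp.
  by apply: poly_approx_sub gS => t [/rspec_scalar->|/specA].
have C1 x : fcalc g Ct (V x) = V (C' x).
  have [li bi] := lV.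
  apply/esym; apply: (is_fcalc_intertwine pC.1 bCt li bi _ _ fC fC1).
    by move=> u; rewrite /Ct V'V subrr scaler0 addr0.
  by apply: poly_approx_sub gS => t [/SC|/specC].
have := gm pCt pAt leAC fC1 fA1 (V v).
rewrite C1 VV' V'V; apply: le_trans.
rewrite {1}/V (linD _ _ (is_fcalc_lin fA1)) A1 A2 rdot_sum.
by rewrite prj1D prj2D /= !addr0 !add0r rdotZl.
Qed.

End Jensen.

(** * Operator monotone functions are concave *)

Section MonotoneConcave.
Variables (R : realType) (H : hilbertType R).
Variables (v0 : H) (v0n : v0 != 0) (g : R -> R) (gm : omono g).

Lemma interpolation (f : R -> R) (s : seq R) :
  exists p : {poly R}, forall t, t \in s -> p.[t] = f t.
Proof.
elim: s => [|a s [p pf]]; first by exists 0.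
have [as_|as_] := boolP (a \in s).
  by exists p => t; rewrite inE => /orP[/eqP->|]; exact: pf.
pose q := \prod_(x <- s) ('X - x%:P).
have qa : q.[a] != 0.
  by apply: contra as_ => qa; rewrite -root_prod_XsubC /root.
exists (p + ((f a - p.[a]) / q.[a]) *: q) => t; rewrite inE !hornerE.
move=> /orP[/eqP->|ts]; first by field.
have /eqP -> : q.[t] == 0 by rewrite -/(root q t) root_prod_XsubC.
by rewrite mulr0 addr0 pf.
Qed.

(** On a finite set there is nothing to require of [f]; this lets [omono] be applied
    to scalar operators before the continuity of [g] is known. *)
Lemma poly_approx_seq (f : R -> R) (s : seq R) : poly_approx f [set` s].
Proof.
move=> e e0; have [p pf] := interpolation f s.
by exists p => t /= ts; rewrite pf// subrr normr0 ltW.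
Qed.

Let p0 : 0 < rdot v0 v0.
Proof. by rewrite lt_neqAle eq_sym rdot_eq0 v0n rdot_ge0. Qed.

Lemma omono_homo (x y : R) : 0 < x -> x <= y -> g x <= g y.
Proof.
move=> x0 xy; have y0 : 0 < y by exact: lt_le_trans xy.
have := gm (posop_scalar H y0) (posop_scalar H x0) _ (is_fcalc_scalar H g y)
  (is_fcalc_scalar H g x).
move=> /(_ _ v0); rewrite !rdotZl ler_pM2r//; apply=> v.
by rewrite !rdotZl ler_wpM2r// rdot_ge0.
Qed.

(** The Jensen inequality for the scalar operators [b], [d] and the scalar
    contractions [sqrt th] and [sqrt (1 - th)]. *)
Lemma omono_mean (b d th eta : R) : 0 < b -> 0 < d -> 0 <= th <= 1 -> 0 < eta ->
  th * g b + (1 - th) * g d <= g ((1 + eta) * (th * b + (1 - th) * d)).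
Proof.
move=> b0 d0 /andP[th0 th1] e0; set c := (1 + eta) * _.
have t1 : 0 <= 1 - th by rewrite subr_ge0.
have c0 : 0 < c.
  rewrite mulr_gt0//; first by rewrite addr_gt0.
  have [->|thn] := eqVneq th 0; first by rewrite mul0r add0r subr0 mul1r.
  by rewrite ltr_pwDl ?mulr_ge0 ?(ltW d0)// mulr_gt0// lt_neqAle eq_sym thn.
pose a := Num.max b d.
have sqr_scal (s : R) (x : H) : 0 <= s ->
    (Num.sqrt s)%:C *: ((Num.sqrt s)%:C *: x) = s%:C *: x.
  by move=> s0; rewrite scalerA -rcM -expr2 sqr_sqrt.
have adj (s : R) (u v : H) : rdot (s%:C *: u) v = rdot u (s%:C *: v).
  by rewrite rdotZl rdotZr.
have lsc (s : R) : lbd (fun v : H => s%:C *: v) by exact/lbd_scale/lbd_id.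
have dot2 (s k : R) (v : H) : 0 <= s ->
    k * (Num.sqrt s * (Num.sqrt s * rdot v v)) = k * s * rdot v v.
  by move=> s0; rewrite (mulrA (Num.sqrt s)) -expr2 sqr_sqrt// mulrA.
have jen := @omono_jensen R H g gm _ _ _ _
  (fun v => (Num.sqrt th)%:C *: v) (fun v => (Num.sqrt th)%:C *: v)
  (fun v => (Num.sqrt (1 - th))%:C *: v) (fun v => (Num.sqrt (1 - th))%:C *: v)
  d a eta [set` [:: b; c; d; (1 + eta^-1) * a]]
  (posop_scalar H b0) (posop_scalar H c0) (is_fcalc_scalar H g b) (is_fcalc_scalar H g c)
  (lsc _) (lsc _) (lsc _) (lsc _) (adj _) (adj _).
have {jen} := jen _ d0 e0 _ _ _ _ _ _ (poly_approx_seq g _) _ v0.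
rewrite !rdotZl !rdotZr !dot2// -mulrDl ler_pM2r// (mulrC (g b)) (mulrC (g d)).
apply.
- by move=> v; rewrite !sqr_scal// -scalerDl -rcD addrC subrK scale1r.
- by rewrite le_max lexx orbT.
- by move=> v; rewrite rdotZl ler_wpM2r ?rdot_ge0// le_max lexx.
- by move=> t /rspec_scalar ->; rewrite /= !inE eqxx.
- by move=> t /rspec_scalar ->; rewrite /= !inE eqxx orbT.
- by rewrite /= !inE eqxx !orbT.
- by rewrite /= !inE eqxx !orbT.
move=> v; rewrite !rdotZl !rdotZr !dot2// /c le_eqVlt; apply/orP; left; apply/eqP.
ring.
Qed.

(** For every [th] below [(x - a) / (y - a)], the mean [th y + (1 - th) a] is less
    than [x], which leaves room for the factor [1 + eta] of [omono_mean]. *)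
Lemma omono_concave (a x y : R) : 0 < a -> a < x -> x < y ->
  (x - a) * (g y - g a) <= (g x - g a) * (y - a).
Proof.
move=> a0 ax xy; have ya : 0 < y - a by rewrite subr_gt0 (lt_trans ax).
have x0 : 0 < x by exact: lt_trans ax.
rewrite -ler_pdivrMr// mulrAC -subr_le0.
set th0 := (x - a) / (y - a).
have D0 : 0 <= g y - g a by rewrite subr_ge0 omono_homo// ltW// (lt_trans ax).
apply: (@le0_small_mul _ _ (g y - g a)) => e e0.
pose th := Num.max 0 (th0 - e).
have th00 : 0 < th0 by rewrite divr_gt0// subr_gt0.
have th_lt : th < th0 by rewrite gt_max th00 gtrBl.
have th01 : th0 <= 1 by rewrite ler_pdivrMr// mul1r lerD2r ltW.
have th_ge0 : 0 <= th by rewrite le_max lexx.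
pose z := th * y + (1 - th) * a.
have z0 : 0 < z.
  rewrite ltr_wpDl ?mulr_ge0// ?(ltW (lt_trans x0 xy))// mulr_gt0// subr_gt0.
  exact: lt_le_trans th01.
have zx : z < x.
  have : th * (y - a) < x - a by rewrite -ltr_pdivlMr.
  by rewrite /z; lra.
have eta0 : 0 < x / z - 1 by rewrite subr_gt0 ltr_pdivlMr// mul1r.
have := @omono_mean y a th (x / z - 1) (lt_trans x0 xy) a0 _ eta0.
rewrite -/z th_ge0 (ltW (lt_le_trans th_lt th01)) => /(_ isT).
rewrite [1 + (x / z - 1)]addrC subrK divfK ?gt_eqF// => h.
have : (th0 - e) * (g y - g a) <= th * (g y - g a).
  by rewrite ler_wpM2r// le_max lexx orbT.
by move: h; lra.
Qed.

Lemma omono_slopes (a x y : R) : 0 < a -> a < x -> x < y ->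
  (x - a) * (g y - g x) <= (g x - g a) * (y - x).
Proof. by move=> a0 ax xy; have := omono_concave a0 ax xy; lra. Qed.

(** Comparing slopes with those on [[a/2, a]] shows that [g] is Lipschitz on
    [[a, b]]. *)
Lemma omono_locally_approx : locally_approx g.
Proof.
move=> a b a0 ab; apply: poly_approx_itv => //.
have a2 : 0 < a / 2 by rewrite divr_gt0.
have a2a : a / 2 < a by lra.
have D0 : 0 <= g b - g (a / 2) by rewrite subr_ge0 omono_homo//; lra.
apply: (@lipschitz_quad_modulus _ _ _ _ ((g b - g (a / 2)) / (a / 2))).
  by rewrite divr_ge0// ltW.
move=> x y ax; rewrite le_eqVlt => /orP[/eqP<- _|xy yb].
  by rewrite !subrr normr0 mulr0.
have x0 : 0 < x by exact: lt_le_trans ax.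
have xyg : g x <= g y by rewrite omono_homo// ltW.
rewrite distrC ger0_norm ?subr_ge0// mulrAC ler_pdivlMr//.
have h1 := omono_slopes a2 (lt_le_trans a2a ax) xy.
have h2 : (g y - g x) * (a / 2) <= (x - a / 2) * (g y - g x).
  by rewrite mulrC ler_wpM2r ?subr_ge0//; lra.
have h3 : (g x - g (a / 2)) * (y - x) <= (g b - g (a / 2)) * (y - x).
  rewrite ler_wpM2r ?subr_ge0 ?(ltW xy)// lerD2r omono_homo//.
  exact: le_trans (ltW xy) yb.
exact: le_trans h2 (le_trans h1 h3).
Qed.

(** A quantitative form of strict monotonicity. Where [g x < g 2], concavity bounds
    the slope on [[x/s, x]] below by the slope on [[x, 2]]; elsewhere monotonicity
    suffices. The bound stays useful even if [g] were constant from [2] on. *)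
Lemma omono_div_le (m s x : R) : 0 < m -> 1 < s -> m <= x ->
  g (x / s) <= g x - m * (1 - s^-1) / 2 * (g 2 - g x).
Proof.
move=> m0 s1 mx; have x0 : 0 < x by exact: lt_le_trans mx.
have s0 : 0 < s by exact: lt_trans s1.
have si : s^-1 < 1 by rewrite invf_lt1.
have k0 : 0 <= m * (1 - s^-1) / 2.
  by rewrite divr_ge0// mulr_ge0 ?subr_ge0 ?ltW.
have xs0 : 0 < x / s by rewrite divr_gt0.
have xs : x / s < x by rewrite ltr_pdivrMr// ltr_pMr.
have [x2|x2] := leP 2 x.
  have : m * (1 - s^-1) / 2 * (g 2 - g x) <= 0.
    by rewrite mulr_ge0_le0// subr_le0 omono_homo.
  by have : g (x / s) <= g x by [rewrite omono_homo// ltW]; lra.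
have h := omono_slopes xs0 xs x2.
have D0 : 0 <= g 2 - g x by rewrite subr_ge0 omono_homo// ltW.
have D1 : 0 <= g x - g (x / s) by rewrite subr_ge0 omono_homo// ltW.
have h1 : m * (1 - s^-1) * (g 2 - g x) <= (x - x / s) * (g 2 - g x).
  rewrite ler_wpM2r//.
  have -> : x - x / s = x * (1 - s^-1) by ring.
  by rewrite ler_wpM2r// subr_ge0 ltW.
have h2 : (g x - g (x / s)) * (2 - x) <= (g x - g (x / s)) * 2.
  by rewrite ler_wpM2l// gerBl ltW.
have h3 := le_trans h1 (le_trans h h2).
have : m * (1 - s^-1) / 2 * (g 2 - g x) = m * (1 - s^-1) * (g 2 - g x) / 2 by ring.
by move=> ->; rewrite lerBrDl -lerBrDr ler_pdivrMr.
Qed.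

(** Otherwise [g] would vanish on [[1, y]], and its derivative at [1] would be
    [0]. *)
Lemma omono_gt0 (y : R) : g 1 = 0 -> is_derive (1 : R) 1 g 1 -> 1 < y -> 0 < g y.
Proof.
move=> g1 [dg dg1] y1; rewrite lt_neqAle.
have ge0 x : 1 <= x -> 0 <= g x by move=> /(omono_homo ltr01); rewrite g1.
rewrite ge0 ?(ltW y1)// andbT; apply/negP => /eqP gy.
have flat x : 1 <= x -> x <= y -> g x = 0.
  move=> x1 xy; apply/eqP; rewrite eq_le ge0// andbT gy.
  by rewrite omono_homo// (lt_le_trans ltr01).
have : (fun h : R => h^-1 *: ((g \o shift 1) (h *: 1) - g 1)) @ 0^' --> (1 : R).
  by rewrite -[X in _ --> X]dg1; exact: dg.
move=> /cvgrPdist_lt/(_ 1 ltr01)/nbhs_ballP[/= r r0 hr].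
pose h := Num.min (r / 2) (y - 1).
have h0 : 0 < h by rewrite lt_min divr_gt0//= subr_gt0.
have := hr h; rewrite /ball /= sub0r normrN gtr0_norm// => /(_ _ _).
rewrite /GRing.scale /= mulr1 g1 flat; last 2 first.
- by rewrite lerDr ltW.
- by rewrite -lerBrDr ge_min lexx orbT.
rewrite subr0 mulr0 subr0 normr1 ltxx => /(_ _ _)/negP; apply=> //.
  by rewrite gt_min ltr_pdivrMr// ltr_pMr// ltr1n.
by rewrite gt_eqF.
Qed.

End MonotoneConcave.

(** * Hansen's inequality and the functions g_p *)

Section Hansen.
Variable R : realType.
Implicit Types H : hilbertType R.

(** One interval contains both spectra, [d], and the constant [N] of
    [omono_jensen]. *)
Lemma omono_jensen_local H (g : R -> R) (B B' C C' K K' L L' : H -> H)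
    (d eta : R) :
  omono g -> locally_approx g -> posop B -> posop C ->
  is_fcalc g B B' -> is_fcalc g C C' ->
  lbd K -> lbd K' -> lbd L -> lbd L' ->
  (forall u v, rdot (K u) v = rdot u (K' v)) ->
  (forall u v, rdot (L u) v = rdot u (L' v)) ->
  (forall v, K (K' v) + L (L' v) = v) -> 0 < d -> 0 < eta ->
  (forall v, (1 + eta) * (rdot (B (K' v)) (K' v) + d * rdot (L' v) (L' v))
     <= rdot (C v) v) ->
  forall v, rdot (B' (K' v)) (K' v) + g d * rdot (L' v) (L' v) <= rdot (C' v) v.
Proof.
move=> gm ga pB pC fB fC lK lK' lL lL' KK LL KL d0 e0 BC v.
have [mB [MB [mB0 mMB hB]]] := posop_rspec pB.
have [mC [MC [mC0 mMC hC]]] := posop_rspec pC.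
have [_ [m [M [m0 mM mMB']]]] := pB.
pose a := Num.max d M; pose N := (1 + eta^-1) * a.
have da : d <= a by rewrite le_max lexx.
have aN : a <= N.
  by rewrite /N ler_peMl ?lerDl ?invr_ge0 ?(ltW e0)// (le_trans (ltW d0)).
pose lo := Num.min d (Num.min mB mC).
pose hi := N + `|MB| + `|MC| + 1.
have lo0 : 0 < lo by rewrite !lt_min d0 mB0.
have N0 : 0 < N by exact: lt_le_trans (le_trans da aN).
have hiN : N <= hi by rewrite /hi -!addrA lerDl !addr_ge0.
have hiB : MB <= hi.
  have := ler_norm MB; have := normr_ge0 MC; rewrite /hi; lra.
have hiC : MC <= hi.
  have := ler_norm MC; have := normr_ge0 MB; rewrite /hi; lra.
have lod : lo <= d by rewrite ge_min lexx.
have lohi : lo < hi.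
  apply: le_lt_trans (_ : N < _); first by rewrite (le_trans lod)// (le_trans da).
  by rewrite /hi -!addrA ltrDl !addrA ltr_wpDl// addr_ge0.
apply: (@omono_jensen _ _ g gm B B' C C' K K' L L' d a eta
  [set t | lo <= t <= hi]) => //.
- move=> u; have /andP[_ h] := mMB' u; apply: le_trans h _.
  by rewrite ler_wpM2r ?rdot_ge0// le_max lexx orbT.
- move=> t /hB/andP[h1 h2]; rewrite /= (le_trans h2)// andbT.
  by rewrite (le_trans _ h1)// !ge_min lexx !orbT.
- move=> t /hC/andP[h1 h2]; rewrite /= (le_trans h2)// andbT.
  by rewrite (le_trans _ h1)// !ge_min lexx !orbT.
- by rewrite /= lod (le_trans da)// (le_trans aN).
- by rewrite /= hiN andbT (le_trans lod)// (le_trans da).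
- exact: ga.
Qed.

Lemma psd_sqrt H (T : H -> H) : bsym T -> (forall v, 0 <= rdot (T v) v) ->
  exists2 L : H -> H, bsym L & forall v, L (L v) = T v.
Proof.
move=> bT T0; have [M M0 hM] := rspec_bounded bT.
have h0 t : rspec T t -> 0 <= t.
  by apply: (rspec_ge bT) => v; rewrite mul0r.
have [|L fL] := @is_fcalc_exists _ _ (Num.sqrt : R -> R) T bT.
  apply: poly_approx_sub (poly_approx_itv M0 (@sqrt_quad_modulus R M)) => t Tt.
  by rewrite /= h0//= (le_trans (ler_norm _))// hM.
exists L; first exact: is_fcalc_bsym fL.
have LL : is_fcalc id T (L \o L).
  apply: is_fcalc_ext (is_fcalc_mul bT fL fL) => t Tt.
  by rewrite -expr2 sqr_sqrt// h0.
by move=> v; have /(congr1 (fun f => f v)) := is_fcalc_unique bT LL (is_fcalc_id bT).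
Qed.

Lemma posop_conj H (D X : H -> H) (s : R) : posop D -> posop X ->
  posop (op_powR X s \o D \o op_powR X s).
Proof.
move=> pD pX; have bX := op_powR_bsym s pX.
have [_ [m [M [m0 _ mD]]]] := pD.
have [_ [m' [M' [m'0 _ mX]]]] := op_powR_posop (s + s) pX.
apply: (@posop_intro _ _ _ (m * m')).
- split; first exact: bounded_comp (bounded_comp bX.1 pD.1.1) bX.1.
  by move=> u v; rewrite /= bX.2 pD.1.2 bX.2.
- by rewrite mulr_gt0.
move=> v /=; rewrite bX.2 -mulrA.
have /andP[h _] := mD (op_powR X s v); apply: le_trans h.
rewrite ler_wpM2l ?(ltW m0)// bX.2 -op_powRD// rdotC.
by have /andP[] := mX v.
Qed.

Lemma omono_powR (r : R) : 0 <= r <= 1 -> omono (fun t => t `^ r).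
Proof.
move=> r01 H A B A' B' pA pB BA fA fB.
rewrite -(op_powRE pA fA) -(op_powRE pB fB); exact: loewner_heinz.
Qed.

(** This is [K E^r K <= (K E K)^r] for the contraction [K = X^(1/2)] and
    [E = X^(-1/2) D X^(-1/2)], conjugated by [X^(-1/2)]. It follows from the Jensen
    inequality for the power [r]; since the power is homogeneous, the error terms
    are absorbed by replacing [D] by [(1 + e) D]. *)
Lemma hansen_pow H (D X : H -> H) (r : R) : posop D -> posop X -> ole X id ->
  0 <= r <= 1 ->
  ole (op_powR (op_powR X (- 2^-1) \o D \o op_powR X (- 2^-1)) r)
      (op_powR X (- 2^-1) \o op_powR D r \o op_powR X (- 2^-1)).
Proof.
move=> pD pX X1 r01; set S := op_powR X (- 2^-1); set E := S \o D \o S.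
set K := op_powR X 2^-1.
have pE : posop E by exact: posop_conj.
have bK : bsym K by exact: op_powR_bsym.
have bS : bsym S by exact: op_powR_bsym.
have SK v : S (K v) = v by exact: op_powRNK.
have KS v : K (S v) = v by exact: op_powRK.
have KK v : K (K v) = X v by rewrite /K -op_powRD// -[2^-1]mul1r -splitr op_powR1.
have b1 : bsym (fun v => v - X v).
  split; last by move=> u v; rewrite rdotBl rdotBr pX.1.2.
  apply: lbd_bounded; apply: lbd_add; first exact: lbd_id.
  by apply: lbd_opp; exact: bsym_lbd pX.1.
have [L bL LL] : exists2 L : H -> H, bsym L & forall v, L (L v) = v - X v.
  by apply: psd_sqrt => // v; rewrite rdotBl subr_ge0; exact: X1.
suff main v : rdot (op_powR E r (K v)) (K v) <= rdot (op_powR D r v) v.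
  by move=> v; have := main (S v); rewrite KS /= bS.2.
set x := rdot (op_powR E r (K v)) (K v); set y := rdot (op_powR D r v) v.
have y0 : 0 <= y.
  by apply: is_fcalc_ge0 (op_powRP r pD) _ _; [exact: pD.1|move=> t _; exact: powR_ge0].
rewrite -subr_le0; apply: (@le0_small_mul _ _ y) => e e0.
have [_ [m [M [m0 _ mD]]]] := pD.
(* chosen so that [(1 + eta)^2 <= 1 + e] *)
pose eta := Num.min 1 e / 3.
have eta0 : 0 < eta by rewrite divr_gt0// lt_min ltr01.
have eta1 : eta <= 1 / 3 by rewrite ler_pM2r ?invr_gt0// ge_min lexx.
have etae : eta <= e / 3 by rewrite ler_pM2r ?invr_gt0// ge_min lexx orbT.
have ec : (1 + eta) * (1 + eta) <= 1 + e by nra.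
have c0 : 0 < 1 + e by rewrite addr_gt0.
have pC : posop (fun v => (1 + e)%:C *: D v) by exact: posop_scale.
have fC := op_powRP r pC; rewrite (op_powR_scale r c0 pD) in fC.
have jen := @omono_jensen_local H (fun t => t `^ r) E (op_powR E r)
  (fun v => (1 + e)%:C *: D v) _ K K L L (eta * m) eta
  (omono_powR r01) (powR_locally_approx r) pE pC (op_powRP r pE) fC
  (bsym_lbd bK) (bsym_lbd bK) (bsym_lbd bL) (bsym_lbd bL) bK.2 bL.2 _ _ eta0 _ v.
have {jen} : x <= (1 + e) `^ r * y.
  rewrite rdotZl in jen.
  apply: le_trans _ (jen _ _ _) => [|u||u].
  - by rewrite lerDl mulr_ge0 ?powR_ge0 ?rdot_ge0.
  - by rewrite KK LL addrC subrK.
  - by rewrite mulr_gt0.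
  - rewrite rdotZl /E /= SK bS.2 SK bL.2 LL rdotBr.
    have /andP[hm _] := mD u.
    have X0 : 0 <= rdot u (X u) by rewrite -KK -bK.2 rdot_ge0.
    have D0 : 0 <= rdot (D u) u by apply: le_trans hm; rewrite mulr_ge0 ?rdot_ge0 ?ltW.
    have h1 : eta * m * (rdot u u - rdot u (X u)) <= eta * rdot (D u) u.
      rewrite -mulrA ler_wpM2l ?(ltW eta0)//; apply: le_trans hm.
      by rewrite ler_wpM2l ?(ltW m0)// gerBl.
    have h2 : (1 + eta) * (1 + eta) * rdot (D u) u <= (1 + e) * rdot (D u) u.
      by rewrite ler_wpM2r.
    by apply: le_trans h2; rewrite -mulrA ler_wpM2l ?addr_ge0 ?(ltW eta0)//; lra.
have : (1 + e) `^ r * y <= (1 + e) * y.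
  by rewrite ler_wpM2r// ler1_powR//; [lra|case/andP: r01].
by lra.
Qed.

Lemma is_fcalc_power_transform H (g : R -> R) (p : R) (A : H -> H) :
  locally_approx g -> posop A ->
  is_fcalc (power_transform p g) A
    (fun v => p%:C *: fcalc g (op_powR A p^-1) v).
Proof.
move=> ga pA; have [a [b [a0 ab]]] := powR_rspec_bounds p^-1 pA.
have := posop_comp pA (op_powR_posop p^-1 pA) (op_powRP p^-1 pA) a0 ab ga.
exact: is_fcalc_scale pA.1.
Qed.

Lemma omono_power_transform (g : R -> R) (p : R) : omono g -> locally_approx g ->
  1 <= p -> omono (power_transform p g).
Proof.
move=> gm ga p1 H A B A' B' pA pB BA fA fB v.
have p0 : 0 < p by exact: lt_le_trans p1.
have q01 : 0 <= p^-1 <= 1 by rewrite invr_ge0 (ltW p0) invf_le1.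
rewrite (is_fcalc_unique pA.1 fA (is_fcalc_power_transform p ga pA)).
rewrite (is_fcalc_unique pB.1 fB (is_fcalc_power_transform p ga pB)).
rewrite !rdotZl ler_wpM2l ?(ltW p0)//.
have pA' := op_powR_posop p^-1 pA; have pB' := op_powR_posop p^-1 pB.
apply: gm pA' pB' _ (posop_fcalc pA' ga) (posop_fcalc pB' ga) v.
exact: loewner_heinz.
Qed.

Lemma operator_monotone_omono (g : R -> R) : operator_monotone g -> omono g.
Proof.
move=> gm H A B A' B' pA pB BA fA fB.
have [lA lB] := (bsym_lin pA.1, bsym_lin pB.1).
have le_BA : op_le B A by apply/op_leP => //; [exact: pA.1.2|exact: pB.1.2].
have sA : selfadjoint A by apply/selfadjointP => //; exact: pA.1.2.
have sB : selfadjoint B by apply/selfadjointP => //; exact: pB.1.2.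
have := gm H A B pA.1.1 sA (posop_spectrum pA) pB.1.1 sB (posop_spectrum pB) le_BA.
rewrite (fcalcE pA.1 fA) (fcalcE pB.1 fB).
have [bA' bB'] := (is_fcalc_bsym pA.1 fA, is_fcalc_bsym pB.1 fB).
by move=> /op_leP; apply; [exact: bsym_lin|exact: bsym_lin|exact: bA'.2|exact: bB'.2].
Qed.

End Hansen.

(** * Comparison for the Karcher equation *)

Section Comparison.
Variable R : realType.

Lemma finite_lower_bound n (m : 'I_n -> R) : (forall i, 0 < m i) ->
  exists2 c : R, 0 < c & forall i, c <= m i.
Proof.
move=> m0; have s0 : 0 <= \sum_i (m i)^-1.
  by apply: sumr_ge0 => i _; rewrite invr_ge0 ltW.
(* a smooth substitute for the minimum, which also covers [n = 0] *)
exists (1 + \sum_i (m i)^-1)^-1 => [|i]; first by rewrite invr_gt0 ltr_pwDl.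
rewrite invf_ple ?posrE ?ltr_pwDl// (bigD1 i)//= addrCA lerDl.
by rewrite addr_ge0// sumr_ge0// => j _; rewrite invr_ge0 ltW.
Qed.

Variables (H : hilbertType R) (v0 : H) (v0n : v0 != 0) (h : R -> R).
Hypotheses (hm : omono h) (h1 : h 1 = 0) (h2 : 0 < h 2).
Variables (n : nat) (w : 'I_n -> R) (D : 'I_n -> H -> H) (X Y : H -> H).
Hypotheses (w0 : forall i, 0 < w i) (w1 : \sum_i w i = 1).
Hypotheses (pD : forall i, posop (D i)) (pX : posop X) (pY : posop Y).

Let SX := op_powR X (- 2^-1).
Let SY := op_powR Y (- 2^-1).
Let E i := SX \o D i \o SX.
Let F i := SY \o D i \o SY.

Hypotheses
  (hE : forall v, \sum_i w i * rdot (fcalc h (E i) v) v <= 0)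
  (hF : forall v, 0 <= \sum_i w i * rdot (fcalc h (F i) v) v).

Let ha : locally_approx h.
Proof. exact: (@omono_locally_approx _ _ _ v0n _ hm). Qed.

Let pE i : posop (E i). Proof. exact: posop_conj. Qed.
Let pF i : posop (F i). Proof. exact: posop_conj. Qed.

Let bSX : bsym SX. Proof. exact: op_powR_bsym. Qed.
Let bSY : bsym SY. Proof. exact: op_powR_bsym. Qed.

Let KX := op_powR X 2^-1.
Let KY := op_powR Y 2^-1.
Let bKX : bsym KX. Proof. exact: op_powR_bsym. Qed.
Let bKY : bsym KY. Proof. exact: op_powR_bsym. Qed.
Let KXX v : KX (KX v) = X v.
Proof. by rewrite /KX -op_powRD// -[2^-1]mul1r -splitr op_powR1. Qed.
Let KYY v : KY (KY v) = Y v.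
Proof. by rewrite /KY -op_powRD// -[2^-1]mul1r -splitr op_powR1. Qed.
Let SKX v : SX (KX v) = v. Proof. exact: op_powRNK. Qed.
Let KSX v : KX (SX v) = v. Proof. exact: op_powRK. Qed.
Let SKY v : SY (KY v) = v. Proof. exact: op_powRNK. Qed.

(** Dividing all [E i] by [s > 1] amounts to enlarging [X]; by [omono_div_le] the
    Karcher sum decreases by a multiple of [h 2], up to a multiple of itself, which
    is nonpositive. *)
Lemma scaled_sum_neg (m s : R) : 0 < m -> 1 < s ->
  (forall i v, m * rdot v v <= rdot (E i v) v) ->
  exists2 c : R, 0 < c & forall v,
    \sum_i w i * rdot (fcalc h (fun u => s^-1%:C *: E i u) v) v <= - c * rdot v v.
Proof.
move=> m0 s1 mE; pose k := m * (1 - s^-1) / 2.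
have s0 : 0 < s by exact: lt_trans s1.
have k0 : 0 < k by rewrite divr_gt0// mulr_gt0// subr_gt0 invf_lt1.
exists (k * h 2) => [|v]; first by rewrite mulr_gt0.
have bound i : rdot (fcalc h (fun u => s^-1%:C *: E i u) v) v <=
    (1 + k) * rdot (fcalc h (E i) v) v + (- (k * h 2)) * rdot v v.
  have si0 : 0 < s^-1 by rewrite invr_gt0.
  have pEs : posop (fun u => s^-1%:C *: E i u) by exact: posop_scale.
  have [a [b [a0 _ ab]]] := posop_rspec (pE i).
  have fs := @posop_comp R H (fun t => s^-1 * t) h _ _ (s^-1 * a) (s^-1 * b) (pE i) pEs
    (is_fcalc_scale _ (pE i).1 (is_fcalc_id (pE i).1)) (mulr_gt0 si0 a0) _ ha.
  rewrite -!rdotZl -rdotDl.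
  have fr := is_fcalc_add (is_fcalc_scale (1 + k) (pE i).1 (posop_fcalc (pE i) ha))
    (is_fcalc_const (- (k * h 2)) (pE i).1) (pE i).1.
  apply: (is_fcalc_le (pE i).1 (fs _) fr).
    by move=> t /ab/andP[ta tb]; rewrite !ler_wpM2l ?(ltW si0).
  move=> t Et; have mt : m <= t by apply: (rspec_ge (pE i).1 _ Et); exact: mE.
  have := omono_div_le v0n hm m0 s1 mt.
  by rewrite /= (mulrC s^-1) -/k; lra.
apply: le_trans (_ : \sum_i w i * ((1 + k) * rdot (fcalc h (E i) v) v
    + (- (k * h 2)) * rdot v v) <= _).
  by apply: ler_sum => i _; rewrite ler_wpM2l ?(ltW (w0 i)).
have -> : \sum_i w i * ((1 + k) * rdot (fcalc h (E i) v) v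
    + (- (k * h 2)) * rdot v v) =
  (1 + k) * (\sum_i w i * rdot (fcalc h (E i) v) v)
   + (\sum_i w i) * (- (k * h 2) * rdot v v).
  rewrite mulr_sumr mulr_suml -big_split /=; apply: eq_bigr => i _; ring.
by rewrite w1 mul1r gerDr mulr_ge0_le0// addr_ge0// ltW.
Qed.

(** [K = (t X)^(-1/2) Y^(1/2)] is a contraction with [K (F i) K' = E i / t]. The
    Jensen inequality with [L L = 1 - K K'], summed with the weights, reads
    [0 + h d (1 - K K') <= - c]: so [1 - K K'] is coercive, that is [Y <= t' X] with
    [t' < t]. *)
Lemma improve_bound (t : R) : 1 < t -> (forall v, rdot (Y v) v <= t * rdot (X v) v) ->
  exists2 t', t' < t & forall v, rdot (Y v) v <= t' * rdot (X v) v.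
Proof.
move=> t1 YX; have t0 : 0 < t by exact: lt_trans t1.
have /choice[mi mE] : forall i, exists m : R, 0 < m /\
    forall v, m * rdot v v <= rdot (E i v) v.
  move=> i; have [_ [m [M [m0 _ mE]]]] := pE i; exists m; split=> // v.
  by have /andP[] := mE v.
have [m m0 mm] := finite_lower_bound (fun i => (mE i).1).
have {}mE i v : m * rdot v v <= rdot (E i v) v.
  by apply: le_trans ((mE i).2 v); rewrite ler_wpM2r ?rdot_ge0.
pose s := (1 + t) / 2.
have s1 : 1 < s by rewrite /s; lra.
have st : s < t by rewrite /s; lra.
have s0 : 0 < s by exact: lt_trans s1.
have [c c0 hc] := scaled_sum_neg m0 s1 mE.
(* chosen so that [(1 + eta)^2 <= t / s]: one factor comes from the Jensen
   inequality, the other absorbs [d], small compared with the bound [m] *)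
pose eta := Num.min 1 (t / s - 1) / 3.
have ts1 : 0 < t / s - 1 by rewrite subr_gt0 ltr_pdivlMr// mul1r.
have eta0 : 0 < eta by rewrite divr_gt0// lt_min ltr01.
have eta1 : eta <= 1 / 3 by rewrite ler_pM2r ?invr_gt0// ge_min lexx.
have etas : eta <= (t / s - 1) / 3 by rewrite ler_pM2r ?invr_gt0// ge_min lexx orbT.
have ets : (1 + eta) * (1 + eta) <= t / s by nra.
pose d := Num.min 1 (eta * (m / t)).
have d0 : 0 < d by rewrite lt_min ltr01/= mulr_gt0// divr_gt0.
have d1 : d <= 1 by rewrite ge_min lexx.
have dm : d <= eta * (m / t) by rewrite ge_min lexx orbT.
have hd : h d <= 0 by rewrite -h1 (omono_homo v0n hm).
pose r := Num.sqrt t^-1.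
have rr : r * r = t^-1 by rewrite -expr2 sqr_sqrt// invr_ge0 ltW.
pose K v := r%:C *: SX (KY v); pose K' v := r%:C *: KY (SX v).
have bsc (T : H -> H) : bsym T -> lbd T by exact: bsym_lbd.
have lK : lbd K by apply: lbd_scale; apply: lbd_comp; exact: bsc.
have lK' : lbd K' by apply: lbd_scale; apply: lbd_comp; exact: bsc.
have KK u v : rdot (K u) v = rdot u (K' v).
  by rewrite rdotZl rdotZr bSX.2 bKY.2.
have KK' v : K (K' v) = t^-1%:C *: SX (Y (SX v)).
  by rewrite /K (linZ _ _ (bsym_lin bKY)) (linZ _ _ (bsym_lin bSX)) scalerA -rcM rr KYY.
pose Q v := v - K (K' v).
have QE v : rdot (Q v) v = rdot v v - t^-1 * rdot (Y (SX v)) (SX v).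
  by rewrite /Q rdotBl KK' rdotZl bSX.2.
have Q0 v : 0 <= rdot (Q v) v.
  rewrite QE subr_ge0 mulrC ler_pdivrMr// mulrC (le_trans (YX _))//.
  rewrite ler_wpM2l ?(ltW t0)// -KXX bKX.2 KSX.
  by rewrite -[X in _ <= X]/(rdot v v).
have bQ : bsym Q.
  split; first by apply: lbd_bounded; apply: lbd_add; [exact: lbd_id|apply: lbd_opp; exact: lbd_comp].
  move=> u v; rewrite /Q rdotBl rdotBr !KK' rdotZl rdotZr.
  by rewrite bSX.2 pY.1.2 bSX.2.
have [L bL LL] := psd_sqrt bQ Q0.
have jen i v : rdot (fcalc h (F i) (K' v)) (K' v) + h d * rdot (L v) (L v) <=
    rdot (fcalc h (fun u => s^-1%:C *: E i u) v) v.
  have pEs : posop (fun u => s^-1%:C *: E i u) by apply: posop_scale; rewrite ?invr_gt0.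
  apply: (@omono_jensen_local R H h (F i) _ _ _ K K' L L d eta hm ha (pF i) pEs
    (posop_fcalc (pF i) ha) (posop_fcalc pEs ha) lK lK' (bsc _ bL) (bsc _ bL)
    KK bL.2 _ d0 eta0) => u.
    by rewrite LL /Q addrC subrK.
  have -> : rdot (F i (K' u)) (K' u) = t^-1 * rdot (E i u) u.
    rewrite /F /E /K' /= (linZ _ _ (bsym_lin bSY)) SKY (linZ _ _ (bsym_lin (pD i).1)).
    rewrite (linZ _ _ (bsym_lin bSY)) rdotZl rdotZr mulrA rr.
    by rewrite bSY.2 SKY bSX.2.
  rewrite bL.2 LL rdotZl (rdotC u).
  have Q1 : rdot (Q u) u <= rdot u u.
    rewrite QE gerBl mulr_ge0 ?invr_ge0 ?(ltW t0)//.
    by have := is_fcalc_ge0 pY.1 (is_fcalc_id pY.1) _ (SX u); apply=> z /(rspec_gt0 pY)/ltW.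
  have h3 : d * rdot (Q u) u <= eta * (t^-1 * rdot (E i u) u).
    apply: le_trans (ler_wpM2l (ltW d0) Q1) _.
    apply: le_trans (ler_wpM2r (rdot_ge0 u) dm) _.
    have -> : eta * (m / t) * rdot u u = eta * (t^-1 * (m * rdot u u)) by ring.
    by rewrite ler_wpM2l ?(ltW eta0)// ler_wpM2l ?invr_ge0 ?(ltW t0).
  have E0 : 0 <= t^-1 * rdot (E i u) u.
    by rewrite mulr_ge0 ?invr_ge0 ?(ltW t0)// (le_trans _ (mE i u))// mulr_ge0 ?rdot_ge0 ?ltW.
  apply: le_trans (_ : (1 + eta) * (1 + eta) * (t^-1 * rdot (E i u) u) <= _).
    by rewrite -mulrA ler_wpM2l ?addr_ge0 ?(ltW eta0)//; lra.
  apply: le_trans (ler_wpM2r E0 ets) _.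
  by rewrite mulrAC mulrCA !mulrA mulVf ?gt_eqF// mul1r mulrC.
have main v : c * rdot v v <= (1 - h d) * rdot (Q v) v.
  have : \sum_i w i * (rdot (fcalc h (F i) (K' v)) (K' v) + h d * rdot (L v) (L v))
      <= - c * rdot v v.
    apply: le_trans (hc v); apply: ler_sum => i _.
    by rewrite ler_wpM2l ?(ltW (w0 i)).
  have -> : \sum_i w i * (rdot (fcalc h (F i) (K' v)) (K' v) + h d * rdot (L v) (L v))
    = \sum_i w i * rdot (fcalc h (F i) (K' v)) (K' v) +
      (\sum_i w i) * (h d * rdot (L v) (L v)).
    by rewrite mulr_suml -big_split /=; apply: eq_bigr => i _; rewrite mulrDr.
  rewrite w1 mul1r bL.2 LL (rdotC v (Q v)) => h3.
  by have := hF (K' v); have := Q0 v; lra.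
have q0 : 0 < 1 - h d by lra.
exists (t * (1 - c / (1 - h d))) => [|v].
  by rewrite gtr_pMr// gtrBl divr_gt0.
have := main (KX v); rewrite QE SKX bKX.2 KXX (rdotC v (X v)) => h3.
have : c / (1 - h d) * rdot (X v) v <= rdot (X v) v - t^-1 * rdot (Y v) v.
  by rewrite mulrAC ler_pdivrMr// [leRHS]mulrC.
rewrite lerBrDr -lerBrDl -[X in X - _]mul1r -mulrBl => h4.
have := ler_wpM2l (ltW t0) h4.
by rewrite mulrA mulfV ?gt_eqF// mul1r mulrA.
Qed.

(** The least [t >= 1] with [Y <= t X] exists, since [X] and [Y] are bounded above
    and below, and is [1] by [improve_bound]. *)
Lemma karcher_comparison : ole Y X.
Proof.
have [_ [mX [MX [mX0 _ hX]]]] := pX; have [_ [mY [MY [mY0 mMY hY]]]] := pY.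
have MY0 : 0 < MY by exact: lt_trans mMY.
pose B := [set t : R | 1 <= t /\ forall v, rdot (Y v) v <= t * rdot (X v) v].
have Bne : B !=set0.
  exists (Num.max 1 (MY / mX)); split; first by rewrite le_max lexx.
  move=> v; have /andP[_ h3] := hY v; apply: le_trans h3 _.
  have /andP[h4 _] := hX v.
  apply: le_trans (_ : MY / mX * (mX * rdot v v) <= _).
    by rewrite mulrA divfK ?gt_eqF.
  rewrite ler_pM ?divr_ge0 ?mulr_ge0 ?rdot_ge0 ?(ltW mX0) ?(ltW MY0)//.
  by rewrite le_max lexx orbT.
have Blb : has_lbound B by exists 1 => t [].
have Binf : B (inf B).
  split; first by apply: lb_le_inf => // t [].
  move=> v; have [->|vn] := eqVneq v 0; first by rewrite !rdot0r mulr0.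
  have xv : 0 < rdot (X v) v.
    have /andP[h4 _] := hX v; apply: lt_le_trans h4.
    by rewrite mulr_gt0// lt_neqAle eq_sym rdot_eq0 vn rdot_ge0.
  rewrite -ler_pdivrMr//; apply: lb_le_inf => // t [_ ht].
  by rewrite ler_pdivrMr.
case: (Binf) => le1 YX; move: le1; rewrite le_eqVlt => /orP[/eqP i1|i1].
  by move=> v; have := YX v; rewrite -i1 mul1r.
have [t' t't Yt'] := improve_bound i1 YX.
have : B (Num.max 1 t').
  split; first by rewrite le_max lexx.
  move=> v; apply: le_trans (Yt' v) _; rewrite ler_wpM2r// ?le_max ?lexx ?orbT//.
  have /andP[h4 _] := hX v; apply: le_trans h4.
  by rewrite mulr_ge0 ?rdot_ge0 ?(ltW mX0).
by move=> /(ge_inf Blb); rewrite leNgt gt_max i1 t't.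
Qed.

End Comparison.

(** * Powers of Karcher means and of representing functions *)

Lemma karcher_form (R : realType) (H : hilbertType R) (n : nat) (w : 'I_n -> R)
    (T : 'I_n -> H -> H) (v : H) :
  \sum_i (w i)%:C *: T i v = 0 -> \sum_i w i * rdot (T i v) v = 0.
Proof.
move=> e; rewrite -[RHS](rdot0l v) -e.
elim/big_rec2: _ => [|i x y _ ->]; first by rewrite rdot0l.
by rewrite rdotDl rdotZl.
Qed.

(** The Jensen-type bound [hansen_pow] with exponent [1/p] reads
    [(X^(-1/2) A^p X^(-1/2))^(1/p) <= X^(-1/2) A X^(-1/2)]. Apply [g] and multiply by
    [p]: the left side becomes the value of [g_p]. *)
Lemma power_karcher_sum_le0 (R : realType) (H : hilbertType R) (g : R -> R)
    (n : nat) (w : 'I_n -> R) (A : 'I_n -> H -> H) (X : H -> H) (p : R) :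
  omono g -> locally_approx g -> (forall i, 0 < w i) ->
  (forall i, posop (A i)) -> posop X -> ole X id -> 1 <= p ->
  let S := op_powR X (- 2^-1) in
  (forall v, \sum_i w i * rdot (fcalc g (S \o A i \o S) v) v = 0) ->
  forall v, \sum_i w i *
    rdot (fcalc (power_transform p g) (S \o op_powR (A i) p \o S) v) v <= 0.
Proof.
move=> gm ga w0 pA pX X1 p1 S hX v.
have p0 : 0 < p by exact: lt_le_trans p1.
have q01 : 0 <= p^-1 <= 1 by rewrite invr_ge0 (ltW p0) invf_le1.
apply: (@le_trans _ _ (p * \sum_i w i * rdot (fcalc g (S \o A i \o S) v) v));
  last by rewrite hX mulr0.
rewrite mulr_sumr; apply: ler_sum => i _.
rewrite mulrCA ler_wpM2l ?(ltW (w0 i))//.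
have pD : posop (op_powR (A i) p) by exact: op_powR_posop.
have pE : posop (S \o op_powR (A i) p \o S) by exact: posop_conj.
have pB : posop (S \o A i \o S) by exact: posop_conj.
rewrite (fcalcE pE.1 (is_fcalc_power_transform p ga pE)) rdotZl.
rewrite ler_wpM2l ?(ltW p0)//; have pE' := op_powR_posop p^-1 pE.
apply: gm pB pE' _ (posop_fcalc pB ga) (posop_fcalc pE' ga) v.
have := hansen_pow pD pX X1 q01.
by rewrite (op_powRM _ _ (pA i)) mulfV ?gt_eqF// (op_powR1 (pA i)).
Qed.

(** [y] solves the equation of [g_p] at [x] exactly when [y `^ p^-1] solves that of
    [g] at [x `^ p^-1]. *)
Lemma representing_function_power (R : realType) (g : R -> R) (p lambda : R)
    (f : R -> R) : 0 < p -> is_representing_function g lambda f ->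
  is_representing_function (power_transform p g) lambda
    (fun x => f (x `^ p^-1) `^ p).
Proof.
move=> p0 fg x x0; have p1 : p^-1 * p = 1 by rewrite mulVf ?gt_eqF.
have q0 : 0 < x `^ p^-1 by exact: powR_gt0.
have root (y : R) : 0 < y ->
    (scalar_mean_eq (power_transform p g) lambda x y <->
     scalar_mean_eq g lambda (x `^ p^-1) (y `^ p^-1)).
  move=> y0; rewrite /scalar_mean_eq /power_transform.
  have divE (z : R) : 0 <= z -> (z / y) `^ p^-1 = z `^ p^-1 / y `^ p^-1.
    move=> z0; rewrite powRM ?invr_ge0 ?(ltW y0)// -[y^-1]powR_inv1 ?(ltW y0)//.
    by rewrite powRAC powR_inv1// powR_ge0.
  rewrite !divE ?(ltW x0)// powR1 y0 powR_gt0//.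
  have -> : (1 - lambda) * (p * g (1 / y `^ p^-1)) +
      lambda * (p * g (x `^ p^-1 / y `^ p^-1)) =
    p * ((1 - lambda) * g (1 / y `^ p^-1) + lambda * g (x `^ p^-1 / y `^ p^-1)).
    by ring.
  split=> -[_ e]; split=> //; last by rewrite e mulr0.
  by move/eqP: e; rewrite mulf_eq0 gt_eqF//= => /eqP.
have [[f0 fe] fu] := fg _ q0; split.
  by apply/root; rewrite ?powR_gt0// -powRrM mulfV ?gt_eqF// powRr1 ?ltW.
move=> y ye; have y0 : 0 < y by case: ye.
rewrite -(fu (y `^ p^-1)); last exact/root.
by rewrite -powRrM p1 powRr1 ?ltW.
Qed.

Theorem theorem7 (R : realType) (H : hilbertType R) (g : R -> R) (n : nat)
    (A : 'I_n -> H -> H) (w : 'I_n -> R) :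
  normalized_monotone g ->
  (1 <= n)%N ->
  (forall i, posdef (A i)) ->
  weight w ->
  (forall X : H -> H, is_karcher_mean g w A X -> op_le X id ->
    forall p : R, 1 <= p ->
    forall Y : H -> H,
      is_karcher_mean (power_transform p g) w (fun i => op_powR (A i) p) Y ->
      op_le Y id)
  /\
  (forall p lambda : R, 1 <= p -> 0 <= lambda <= 1 ->
    forall f : R -> R, is_representing_function g lambda f ->
      is_representing_function (power_transform p g) lambda
        (fun x => f (x `^ p^-1) `^ p)).
Proof.
move=> [/operator_monotone_omono gm g1 dg1] _ dA [w0 w1]; split; last first.
  move=> p lambda p1 _ f; apply: representing_function_power.
  exact: lt_le_trans p1.
move=> X [dX hX] X1 p p1 Y [dY hY].
have pA i : posop (A i) by exact: posdef_posop.
have pX := posdef_posop dX; have pY := posdef_posop dY.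
have sym_id : sym (@id H) by [].
have lin_id : linear (@id H) by [].
apply/op_leP => //; [exact: bsym_lin pY.1|exact: pY.1.2|].
(* continuity of [g] comes from scalar operators, hence from a nonzero vector *)
move=> v; have [->|vn] := eqVneq v 0; first by rewrite !rdot0r.
have ga : locally_approx g by exact: (@omono_locally_approx _ _ _ vn _ gm).
have hm := omono_power_transform gm ga p1.
have p0 : 0 < p by exact: lt_le_trans p1.
have Xid : ole X id by apply/op_leP => //; [exact: bsym_lin pX.1|exact: pX.1.2].
have h1 : power_transform p g 1 = 0 by rewrite /power_transform powR1 g1 mulr0.
have h2 : 0 < power_transform p g 2.
  rewrite /power_transform mulr_gt0// (omono_gt0 vn gm g1 dg1)//.
  rewrite [ltLHS](_ : 1 = 1 `^ p^-1); last by rewrite powR1.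
  by rewrite gt0_ltr_powR ?invr_gt0 ?nnegrE ?ltr1n.
have hE := power_karcher_sum_le0 gm ga w0 pA pX Xid p1
  (fun u => karcher_form
     (T := fun i => fcalc g (op_powR X (- 2^-1) \o A i \o op_powR X (- 2^-1)))
     (hX u)).
have hF u := karcher_form (T := fun i => fcalc (power_transform p g)
  (op_powR Y (- 2^-1) \o op_powR (A i) p \o op_powR Y (- 2^-1))) (hY u).
have YX : ole Y X.
  apply: (karcher_comparison vn hm h1 h2 w0 w1 (fun i => op_powR_posop p (pA i))
    pX pY hE) => u.
  by rewrite hF.
exact: le_trans (YX v) (Xid v).
Qed.
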